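(* Let $F$ denote the free group on countably infinitely many generators. There exists an increasing chain of $CSA$-groups ${}^{1}G\leq {}^{2}G\leq \cdots \leq {}^{k-1}G\leq {}^{k}G\leq\cdots$ (indexed by the integers $k\geq 1$) such that ${}^{1}G=\mathbb{Q}\ast F$ (the free product of the additive group of rationals and $F$), each ${}^{k}G$ is generated by a subgroup isomorphic to the additive group $\mathbb{Q}$ together with a subgroup isomorphic to $F$, and the union $\bigcup_{k\geq 1}{}^{k}G$ is a nonabelian $CSA$-group in which any two maximal abelian subgroups are conjugate and every maximal abelian subgroup is divisible.
   Context: A $CSA$-group is a group $\Gamma$ in which every maximal abelian subgroup $A$ is malnormal, i.e. for every $g\in\Gamma$, $A\cap A^{g}\neq 1$ implies $g\in A$, where $A^{g}=g^{-1}Ag$. An abelian group $A$ is divisible if for every integer $n\geq 1$ every element of $A$ has an $n$-th root in $A$. *)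

(* Defs.v *)
From HB Require Import structures.
From mathcomp Require Import all_boot all_order all_algebra.
From mathcomp Require Import boolp classical_sets.

Set Implicit Arguments.
Unset Strict Implicit.
Unset Printing Implicit Defensive.

Local Open Scope classical_set_scope.
Local Open Scope group_scope.
Local Open Scope quotient_scope.

(* The group with generators T and relations R, where the letter [inv t] is
   made to represent the inverse of the letter t: words over T modulo the
   least congruence containing R and the cancellations of t with [inv t]. *)
Section PresentedGroup.
Variables (T : choiceType) (inv : T -> T) (R : seq T -> seq T -> Prop).

Inductive word_cong : seq T -> seq T -> Prop :=
| word_cong_refl u : word_cong u u
| word_cong_sym u v : word_cong u v -> word_cong v u
| word_cong_trans v u w : word_cong u v -> word_cong v w -> word_cong u w
| word_cong_cancel u t v : word_cong (u ++ [:: t; inv t] ++ v) (u ++ v)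
| word_cong_cancelV u t v : word_cong (u ++ [:: inv t; t] ++ v) (u ++ v)
| word_cong_rel u r s v : R r s -> word_cong (u ++ r ++ v) (u ++ s ++ v).

Definition word_congb : rel (seq T) := fun u v => `[< word_cong u v >].

Lemma word_congb_refl : reflexive word_congb.
Proof. by move=> u; apply/asboolP; exact: word_cong_refl. Qed.

Lemma word_congb_sym : symmetric word_congb.
Proof.
by move=> u v; apply/idP/idP => /asboolP h; apply/asboolP; exact: word_cong_sym.
Qed.

Lemma word_congb_trans : transitive word_congb.
Proof.
move=> v u w /asboolP h /asboolP k; apply/asboolP.
exact: word_cong_trans h k.
Qed.

Canonical word_congb_equiv :=
  EquivRel word_congb word_congb_refl word_congb_sym word_congb_trans.

Definition presented_group : Type := {eq_quot word_congb}.
HB.instance Definition _ := EqQuotient.on presented_group.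
HB.instance Definition _ := Choice.on presented_group.

Definition word_class (u : seq T) : presented_group := \pi_presented_group u.

Definition word_inv (u : seq T) : seq T := rev (map inv u).

Definition presented_one : presented_group := word_class [::].
Definition presented_mul (x y : presented_group) : presented_group :=
  word_class (repr x ++ repr y).
Definition presented_inv (x : presented_group) : presented_group :=
  word_class (word_inv (repr x)).

Lemma word_classP u v : word_class u = word_class v <-> word_cong u v.
Proof.
split; first by move=> /eqquotP /asboolP.
by move=> h; apply/eqquotP/asboolP.
Qed.

Lemma word_class_repr (x : presented_group) : word_class (repr x) = x.
Proof. exact: reprK. Qed.

Lemma repr_word_class u : word_cong (repr (word_class u)) u.
Proof. by apply/word_classP; rewrite word_class_repr. Qed.

Lemma word_cong_ctx a b u v :
  word_cong u v -> word_cong (a ++ u ++ b) (a ++ v ++ b).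
Proof.
elim=> {u v} [u|u v _ h|v u w _ h _ k|u t v|u t v|u r s v h].
- exact: word_cong_refl.
- exact: word_cong_sym.
- exact: word_cong_trans h k.
- by have := word_cong_cancel (a ++ u) t (v ++ b); rewrite -!catA.
- by have := word_cong_cancelV (a ++ u) t (v ++ b); rewrite -!catA.
- by have := word_cong_rel (a ++ u) (v ++ b) h; rewrite -!catA.
Qed.

Lemma word_cong_cat u u' v v' :
  word_cong u u' -> word_cong v v' -> word_cong (u ++ v) (u' ++ v').
Proof.
move=> h k; apply: (@word_cong_trans (u' ++ v)).
  exact: (word_cong_ctx [::] v h).
by have := word_cong_ctx u' [::] k; rewrite !cats0.
Qed.

Lemma word_mulE u v :
  presented_mul (word_class u) (word_class v) = word_class (u ++ v).
Proof. by apply/word_classP/word_cong_cat; exact: repr_word_class. Qed.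

Lemma word_mulVw u : word_cong (word_inv u ++ u) [::].
Proof.
rewrite /word_inv; elim: u => [|t u IH]; first exact: word_cong_refl.
rewrite /= rev_cons cat_rcons; apply: (word_cong_trans _ IH).
exact: (word_cong_cancelV (rev (map inv u)) t u).
Qed.

Lemma word_mulwV u : word_cong (u ++ word_inv u) [::].
Proof.
rewrite /word_inv; elim/last_ind: u => [|u t IH]; first exact: word_cong_refl.
rewrite map_rcons rev_rcons cat_rcons; apply: (word_cong_trans _ IH).
exact: (word_cong_cancel u t (rev (map inv u))).
Qed.

Lemma presented_mulA : associative presented_mul.
Proof.
move=> x y z; rewrite -(word_class_repr x) -(word_class_repr y).
by rewrite -(word_class_repr z) !word_mulE catA.
Qed.

Lemma presented_mul1 : left_id presented_one presented_mul.
Proof. by move=> x; rewrite -(word_class_repr x) word_mulE. Qed.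

Lemma presented_mulr1 : right_id presented_one presented_mul.
Proof. by move=> x; rewrite -(word_class_repr x) word_mulE cats0. Qed.

Lemma presented_mulV : left_inverse presented_one presented_inv presented_mul.
Proof.
move=> x; rewrite -{2}(word_class_repr x) word_mulE.
by apply/word_classP/word_mulVw.
Qed.

Lemma presented_mulrV : right_inverse presented_one presented_inv presented_mul.
Proof.
move=> x; rewrite -{1}(word_class_repr x) word_mulE.
by apply/word_classP/word_mulwV.
Qed.

HB.instance Definition _ := isGroup.Build presented_group
  presented_mulA presented_mul1 presented_mulr1 presented_mulV presented_mulrV.

Lemma word_class_nil : word_class [::] = 1. Proof. by []. Qed.

Lemma word_class_cat u v : word_class (u ++ v) = word_class u * word_class v.
Proof. by rewrite -word_mulE. Qed.

Lemma word_class_cons t u : word_class (t :: u) = word_class [:: t] * word_class u.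
Proof. by rewrite -word_class_cat. Qed.

Lemma word_class_inv t : word_class [:: inv t] = (word_class [:: t])^-1.
Proof.
apply: (mulgI (word_class [:: t])); rewrite mulgV -word_class_cat.
by apply/word_classP/(word_cong_cancel [::] t [::]).
Qed.

Lemma word_class_rel r s : R r s -> word_class r = word_class s.
Proof.
move=> h; apply/word_classP.
by have := word_cong_rel [::] [::] h; rewrite !cats0.
Qed.

Section Lift.
Variables (H : groupType) (f : T -> H).
Definition word_eval (u : seq T) : H := \prod_(t <- u) f t.
Hypothesis finv : forall t, f (inv t) = (f t)^-1.
Hypothesis frel : forall r s, R r s -> word_eval r = word_eval s.

Lemma word_eval_cong u v : word_cong u v -> word_eval u = word_eval v.
Proof.
rewrite /word_eval; elim=> {u v} //.
- by move=> v u w _ -> _ ->.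
- move=> u t v; rewrite !big_cat /= !big_cons big_nil finv.
  by rewrite mulg1 mulgV mul1g.
- move=> u t v; rewrite !big_cat /= !big_cons big_nil finv.
  by rewrite mulg1 mulVg mul1g.
- by move=> u r s v /frel h; rewrite !big_cat /= -!/(word_eval _) h.
Qed.

Definition presented_lift (x : presented_group) : H := word_eval (repr x).

Lemma presented_liftE u : presented_lift (word_class u) = word_eval u.
Proof. exact/word_eval_cong/repr_word_class. Qed.

Lemma presented_liftM (x y : presented_group) :
  presented_lift (x * y) = presented_lift x * presented_lift y.
Proof.
rewrite -(word_class_repr x) -(word_class_repr y) -word_class_cat.
by rewrite !presented_liftE /word_eval big_cat.
Qed.

End Lift.

Lemma presented_ind (P : presented_group -> Prop) :
  P 1 -> (forall t x, P x -> P (word_class [:: t] * x)) -> forall x, P x.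
Proof.
move=> P1 PM x; rewrite -(word_class_repr x); elim: (repr x) => // t u IH.
by rewrite word_class_cons; exact: PM.
Qed.

End PresentedGroup.

Section FreeGroup.
Variable X : choiceType.

(* The letter (x, true) is the generator x, and (x, false) its inverse. *)
Definition free_letter_inv (t : X * bool) : X * bool := (t.1, ~~ t.2).

Definition free_group : Type :=
  presented_group free_letter_inv (fun _ _ => False).
HB.instance Definition _ := Group.on free_group.

Definition free_gen (x : X) : free_group := word_class _ _ [:: (x, true)].

Lemma free_group_universal (H : groupType) (f : X -> H) :
  exists! g : free_group -> H,
    {morph g : x y / x * y} /\ forall x, g (free_gen x) = f x.
Proof.
pose f' (t : X * bool) := if t.2 then f t.1 else (f t.1)^-1.
have f'inv t : f' (free_letter_inv t) = (f' t)^-1.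
  by case: t => x [] //; rewrite /f' /= invgK.
have f'rel (r s : seq (X * bool)) : False -> word_eval f' r = word_eval f' s.
  by [].
exists (@presented_lift _ _ _ _ f'); split.
  split; first exact: (presented_liftM f'inv f'rel).
  move=> x; rewrite (presented_liftE f'inv f'rel).
  by rewrite /word_eval big_cons big_nil mulg1.
move=> g [gM gx]; apply/funext => x.
have g1 : g 1 = 1 by apply: (mulgI (g 1)); rewrite -gM !mulg1.
have gV y : g y^-1 = (g y)^-1.
  by apply: (mulgI (g y)); rewrite -gM !mulgV g1.
elim/presented_ind: x => [|[x b] y IH].
  by rewrite g1 -word_class_nil (presented_liftE f'inv f'rel) /word_eval big_nil.
rewrite gM (presented_liftM f'inv f'rel) IH; congr (_ * _).
rewrite (presented_liftE f'inv f'rel) /word_eval big_cons big_nil mulg1.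
case: b; first by rewrite /f' /= -gx.
have -> : word_class _ _ [:: (x, false)] = (free_gen x)^-1 :> free_group.
  exact: (word_class_inv _ _ (x, true)).
by rewrite gV gx.
Qed.

End FreeGroup.

Section FreeProduct.
Variables A B : groupType.

Definition free_product_inv (t : A + B) : A + B :=
  match t with inl a => inl a^-1 | inr b => inr b^-1 end.

Inductive free_product_rel : seq (A + B) -> seq (A + B) -> Prop :=
| free_product_mull a a' :
    free_product_rel [:: inl a; inl a'] [:: inl (a * a')]
| free_product_mulr b b' :
    free_product_rel [:: inr b; inr b'] [:: inr (b * b')].

Definition free_product : Type :=
  presented_group free_product_inv free_product_rel.
HB.instance Definition _ := Group.on free_product.

Definition free_product_inl (a : A) : free_product := word_class _ _ [:: inl a].
Definition free_product_inr (b : B) : free_product := word_class _ _ [:: inr b].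

Lemma free_product_inlM : {morph free_product_inl : x y / x * y}.
Proof.
move=> x y; rewrite /free_product_inl -[RHS]word_class_cat /=.
by apply/esym/word_class_rel; constructor.
Qed.

Lemma free_product_inrM : {morph free_product_inr : x y / x * y}.
Proof.
move=> x y; rewrite /free_product_inr -[RHS]word_class_cat /=.
by apply/esym/word_class_rel; constructor.
Qed.

Lemma free_product_universal (H : groupType)
    (f : UMagmaMorphism.type A H) (g : UMagmaMorphism.type B H) :
  exists! h : free_product -> H,
    [/\ {morph h : x y / x * y},
        forall a, h (free_product_inl a) = f a
      & forall b, h (free_product_inr b) = g b].
Proof.
pose k (t : A + B) := match t with inl a => f a | inr b => g b end.
have kinv t : k (free_product_inv t) = (k t)^-1 by case: t => ? /=; rewrite gmulfV.
have krel r s : free_product_rel r s -> word_eval k r = word_eval k s.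
  by case=> [a b|a b]; rewrite /word_eval !big_cons !big_nil !mulg1 /= gmulfM.
exists (@presented_lift _ _ _ _ k); split.
  by split; [exact: (presented_liftM kinv krel)| |];
    move=> ?; rewrite (presented_liftE kinv krel) /word_eval big_cons big_nil mulg1.
move=> h [hM hl hr]; apply/funext => x.
have h1 : h 1 = 1 by apply: (mulgI (h 1)); rewrite -hM !mulg1.
elim/presented_ind: x => [|t y IH].
  by rewrite h1 -word_class_nil (presented_liftE kinv krel) /word_eval big_nil.
rewrite hM (presented_liftM kinv krel) IH; congr (_ * _).
rewrite (presented_liftE kinv krel) /word_eval big_cons big_nil mulg1.
by case: t => t; rewrite ?hl ?hr; [rewrite -hl | rewrite -hr].
Qed.

End FreeProduct.

(* Groups are handled as subgroups G of an ambient group U; maximality,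
   malnormality and conjugacy are all relative to G. *)
Section Subgroups.
Variable U : groupType.
Implicit Types (G A B S : set U).

Definition is_subgroup G : Prop := group_closed (mem G).

Definition subgroup_generated S : set U := smallest is_subgroup S.

Definition is_abelian A : Prop := forall x y, A x -> A y -> commute x y.

Definition subgroup_iso G (H : groupType) : Prop :=
  exists f : UMagmaMorphism.type H U, injective f /\ range f = G.

(* A^g = g^-1 A g, as x ^ g = g^-1 * (x * g). *)
Definition conj_set A (g : U) : set U := [set x ^ g | x in A].

Definition max_abelian_subgroup G A : Prop :=
  [/\ is_subgroup A, A `<=` G, is_abelian A
    & forall B, is_subgroup B -> B `<=` G -> is_abelian B -> A `<=` B -> B = A].

Definition malnormal G A : Prop :=
  forall g, G g -> A `&` conj_set A g <> [set 1] -> A g.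

Definition CSA_group G : Prop :=
  is_subgroup G /\ forall A, max_abelian_subgroup G A -> malnormal G A.

Definition conjugate_in G A B : Prop := exists2 g, G g & B = conj_set A g.

Definition divisible A : Prop :=
  forall n : nat, (1 <= n)%N -> forall a, A a -> exists2 b, A b & b ^+ n = a.

End Subgroups.

(* The additive group of rationals, in multiplicative notation. *)
Definition rat_group : groupType := Algebra.to_multiplicative rat.

Definition F_omega : groupType := free_group nat.

(* Main.v *)
From HB Require Import structures.
Require Import Defs.
From mathcomp Require Import all_boot all_order all_algebra.
From mathcomp Require Import boolp classical_sets.
From mathcomp Require Import zify.

(* Start with the rationals and let a step turn a countable torsion-free CSA-group G
   containing a malnormal copy M of the rationals into an HNN extension G' with
   countably many stable letters: one for each conjugacy class of maximal abelian
   subgroups of G not conjugate to M, conjugating it into M, and infinitely many free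
   ones. The first step produces the free product of the rationals with F.

   Normal forms make G' act on its Bass-Serre tree, which is only seen through the
   length function counting stable letters and the common prefix of two normal forms,
   a Gromov product. Malnormality makes the action acylindrical: only the identity
   fixes a path of length 3. Hence an elliptic element of G' is conjugate into M,
   while the centralizer of a hyperbolic one embeds in the integers by its Busemann
   cocycle and is malnormal, so that the step can be repeated. In the union every
   nontrivial element is conjugate into M, whose conjugates are thus the maximal
   abelian subgroups.

   Free letters also yield the generation by the rationals and a free group: if t is
   a free letter set aside for an element g <> 1 of G, and q <> 1 lies in M, then
   the elements g t q together with the stable letters are a free basis of a group
   which generates G' together with M. *)

Set Implicit Arguments.
Unset Strict Implicit.
Unset Printing Implicit Defensive.

Local Open Scope classical_set_scope.
Local Open Scope group_scope.

(** * Groups with a tree-like length function *)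

Section TreeLength.
(** The model is an action on a tree with base vertex v: [L a] is the distance from v to a v, and
    [c a b] is the Gromov product of a v and b v seen from v, so that [c_ultra] is
    0-hyperbolicity. *)
Variables (G : groupType) (L : G -> nat) (c : G -> G -> nat).
Implicit Types a b d e g h u : G.
Hypothesis L1 : L 1 = 0.
Hypothesis Lc : forall a b, (L (a^-1 * b) + 2 * c a b = L a + L b)%N.
Hypothesis c_ultra : forall a b d, (minn (c a d) (c d b) <= c a b)%N.

Lemma tree_lengthV a : L a^-1 = L a.
Proof.
have := Lc a 1; have := Lc a^-1 1; rewrite !mulg1 invgK L1 => *; lia.
Qed.

Lemma tree_lengthM a b : (L (a * b) <= L a + L b)%N.
Proof. by rewrite -{1}(invgK a) -(tree_lengthV a) -(Lc a^-1 b) leq_addr. Qed.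

Lemma tree_prodC a b : c a b = c b a.
Proof.
have ab := Lc a b; have ba := Lc b a.
have e : L (a^-1 * b) = L (b^-1 * a) by rewrite -tree_lengthV invgM invgK.
lia.
Qed.

(** Left translation by a^-1 moves the first point to the base vertex; what remains is [c_ultra]
    rewritten through [Lc]. *)
Lemma tree_four_point a b d e :
  (L (a^-1 * b) + L (d^-1 * e) <=
     maxn (L (a^-1 * d) + L (b^-1 * e)) (L (a^-1 * e) + L (b^-1 * d)))%N.
Proof.
have tr u v : u^-1 * v = (a^-1 * u)^-1 * (a^-1 * v).
  by rewrite invgM invgK -mulgA mulVKg.
rewrite (tr d e) (tr b e) (tr b d).
move: (a^-1 * b) (a^-1 * d) (a^-1 * e) => {tr}b {}d {}e.
have := Lc d e; have := Lc b e; have := Lc b d.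
have := c_ultra d e b; rewrite (tree_prodC d b) => *; lia.
Qed.

(** * Hyperbolic elements, the Busemann cocycle and centralizers *)

Section Hyperbolic.
Variable x : G.
(** Together these two say that x is hyperbolic with the base vertex v on its axis: the segments
    from v to x v and to x^-1 v share only v, and x translates by [L x]. *)
Hypothesis Lx_gt0 : (0 < L x)%N.
Hypothesis Lxx : L (x * x) = (2 * L x)%N.
Local Notation n := (L x).

(** There is no backtracking: [c x (x ^+ k.+1)] is positive while [c x^-1 x] is 0, so the
    ultrametric inequality makes [c x^-1 (x ^+ k.+1)] vanish. The induction carries two consecutive
    lengths. *)
Lemma tree_lengthX k : L (x ^+ k) = (k * n)%N.
Proof.
suff [] : L (x ^+ k) = (k * n)%N /\ L (x ^+ k.+1) = (k.+1 * n)%N by [].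
elim: k => [|k [IH0 IH]]; first by rewrite expg0 expg1 L1 mul1n.
split=> //; have -> : x ^+ k.+2 = x * x ^+ k.+1 by rewrite expgS.
have eV := tree_lengthV x.
have c0 : c x^-1 x = 0 by have := Lc x^-1 x; rewrite invgK Lxx eV => *; lia.
have c1 : (0 < c x (x ^+ k.+1))%N.
  have := Lc x (x ^+ k.+1).
  have -> : x^-1 * x ^+ k.+1 = x ^+ k by rewrite expgS mulKg.
  by rewrite IH0 IH => *; nia.
have := c_ultra x^-1 x (x ^+ k.+1); rewrite c0 (tree_prodC _ x) => c2.
have : (L (x * x ^+ k.+1) + 2 * c x^-1 (x ^+ k.+1) = n + k.+1 * n)%N.
  by rewrite -{1}(invgK x) Lc eV IH.
by move=> *; nia.
Qed.

(* The Busemann cocycle of the end of the tree to which the powers of x converge: on the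
   stabilizer of the axis of x it is the signed translation length. *)
Definition busemann_spec g (z : int) : Prop :=
  exists N0, forall N, (N0 <= N)%N ->
    ((L (g * x ^+ N))%:Z = (N * n)%N%:Z + z)%R.

Lemma busemann_exists g : exists z, busemann_spec g z.
Proof.
(* Adding [L g] keeps the difference nonnegative. The sequence u is nonincreasing, hence eventually
   equal to its minimum. *)
pose u N := (L (g * x ^+ N) + L g - N * n)%N.
have lo N : (N * n <= L (g * x ^+ N) + L g)%N.
  have := tree_lengthM g^-1 (g * x ^+ N).
  by rewrite mulKg tree_lengthX tree_lengthV => *; lia.
have step N : (u N.+1 <= u N)%N.
  have h : (L (g * x ^+ N.+1) <= L (g * x ^+ N) + L x)%N.
    by rewrite expgSr mulgA; exact: tree_lengthM.
  by have := lo N; have := lo N.+1; rewrite /u; nia.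
have mono N M : (N <= M)%N -> (u M <= u N)%N.
  elim: M => [|M IH]; first by rewrite leqn0 => /eqP ->.
  rewrite leq_eqVlt => /orP[/eqP -> //|]; rewrite ltnS => /IH.
  exact: leq_trans.
have exv : exists v, `[< exists N, u N = v >] by exists (u 0); apply/asboolP; exists 0.
case: (ex_minnP exv) => v /asboolP[N0 uN0] vmin.
exists (v%:Z - (L g)%:Z)%R, N0 => N N0N.
have e : u N = v.
  apply/eqP; rewrite eqn_leq -{1}uN0 mono //= vmin //.
  by apply/asboolP; exists N.
have := lo N; move: e; rewrite /u => *; lia.
Qed.

Definition busemann g : int := projT1 (cid (busemann_exists g)).

Lemma busemannP g : busemann_spec g (busemann g).
Proof. exact: projT2 (cid (busemann_exists g)). Qed.

Lemma busemann_unique g z : busemann_spec g z -> busemann g = z.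
Proof.
case=> N1 H1; have [N0 H0] := busemannP g.
have := H1 (maxn N0 N1) (leq_maxr _ _).
have := H0 (maxn N0 N1) (leq_maxl _ _) => *; lia.
Qed.

Lemma busemann_gen : busemann x = Posz n.
Proof.
by apply: busemann_unique; exists 0 => N _; rewrite -expgS tree_lengthX; lia.
Qed.

(** Commuting with some positive power of x is easier to establish than commuting with x;
    [axis_stabE] shows that the two conditions agree. *)
Definition axis_stab : set G := [set g | exists2 k, (0 < k)%N & commute g (x ^+ k)].

Lemma axis_stab_gen : axis_stab x.
Proof. by exists 1%N => //; rewrite expg1. Qed.

Lemma axis_stabM g h : axis_stab g -> axis_stab h -> axis_stab (g * h).
Proof.
move=> [k k0 gk] [l l0 hl]; exists (k * l)%N; first by rewrite muln_gt0 k0.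
apply/commute_sym/commuteM; apply/commute_sym.
  by rewrite expgnA; exact: commuteX.
by rewrite mulnC expgnA; exact: commuteX.
Qed.

Lemma axis_stabV g : axis_stab g -> axis_stab g^-1.
Proof.
by move=> [k k0 gk]; exists k => //; apply/commute_sym/commuteV/commute_sym.
Qed.

(** For large N the four-point condition makes L (g x^N h) + L (x^N) equal to L (g x^N) + L (x^N h),
    because the third sum, L g + L h, stays bounded. When k divides N, h commutes with x^N and this
    equality reads as additivity. *)
Lemma busemannM g h : axis_stab g -> axis_stab h ->
  busemann (g * h) = (busemann g + busemann h)%R.
Proof.
move=> _ [k k0 hk].
have [N1 H1] := busemannP g; have [N2 H2] := busemannP h.
have [N3 H3] := busemannP (g * h).
(* M exceeds the three thresholds and L g + L h; N is a multiple of k above it. *)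
pose M := (N1 + N2 + N3 + L g + L h + 1)%N; pose N := (k * M)%N.
have MN : (M <= N)%N by rewrite /N leq_pmull.
have hN : h * x ^+ N = x ^+ N * h by rewrite /N expgnA; exact: commuteX.
have e1 := H1 N ltac:(lia); have e2 := H2 N ltac:(lia).
have e3 : (Posz (L (g * x ^+ N * h)) = (N * n)%N%:Z + busemann (g * h))%R.
  by rewrite -mulgA -hN mulgA H3 //; lia.
have {}e2 : (Posz (L (x ^+ N * h)) = (N * n)%N%:Z + busemann h)%R by rewrite -hN.
have lN := tree_lengthX N; have Nn : (N <= N * n)%N by rewrite leq_pmulr.
have VN : (x ^+ N * h)^-1 * x ^+ N = h^-1 by rewrite invgM mulgVK.
have p1 : (L (g * x ^+ N * h) + L (x ^+ N) <=
    maxn (L g + L h) (L (g * x ^+ N) + L (x ^+ N * h)))%N.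
  have := tree_four_point g^-1 (x ^+ N * h) 1 (x ^+ N).
  by rewrite VN invgK invg1 !mul1g !mulg1 !tree_lengthV mulgA.
have p2 : (L (g * x ^+ N) + L (x ^+ N * h) <=
    maxn (L (g * x ^+ N * h) + L (x ^+ N)) (L g + L h))%N.
  have := tree_four_point g^-1 (x ^+ N) (x ^+ N * h) 1.
  by rewrite mulKg invgK !mulg1 !tree_lengthV mulgA addnC.
have p3 : (L (x ^+ N) <= L g + L (g * x ^+ N))%N.
  by rewrite -{1}(mulKg g (x ^+ N)) -(tree_lengthV g) tree_lengthM.
have p4 : (L (x ^+ N) <= L (x ^+ N * h) + L h)%N.
  by rewrite -{1}(mulgK h (x ^+ N)) -(tree_lengthV h) tree_lengthM.
move: p1 p2; rewrite /M in MN *; lia.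
Qed.

Lemma busemann1 : busemann 1 = 0%R.
Proof.
apply: busemann_unique; exists 0 => N _.
by rewrite mul1g tree_lengthX GRing.addr0.
Qed.

Lemma busemannV g : axis_stab g -> busemann g^-1 = (- busemann g)%R.
Proof.
move=> Ag; have := busemannM Ag (axis_stabV Ag); rewrite mulgV busemann1; lia.
Qed.

Hypothesis acyl : forall h p, L h = 0 -> L (h ^ p) = 0 -> (3 <= L p)%N -> h = 1.

(** Since g and g^-1 both have value 0, the four-point condition for 1, g, x^-N and x^N gives L g =
    0. Thus g fixes the base vertex v and, commuting with x^N, also x^N v, at distance at least 3;
    acylindricity concludes. *)
Lemma busemann_eq0 g : axis_stab g -> busemann g = 0%R -> g = 1.
Proof.
move=> Ag g0; have [k k0 gk] := Ag.
have [N1 H1] := busemannP g; have [N2 H2] := busemannP g^-1.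
pose M := (N1 + N2 + 3)%N; pose N := (k * M)%N.
have MN : (M <= N)%N by rewrite /N leq_pmull.
have gN : commute g (x ^+ N) by rewrite /N expgnA; exact: commuteX.
have e1 : (Posz (L (g * x ^+ N)) = (N * n)%N%:Z)%R.
  by rewrite H1 ?g0 ?GRing.addr0 //; lia.
have e2 : (Posz (L (g^-1 * x ^+ N)) = (N * n)%N%:Z)%R.
  by rewrite H2 ?busemannV ?g0 ?GRing.subr0 //; lia.
have lN := tree_lengthX N; have Nn : (N <= N * n)%N by rewrite leq_pmulr.
have p1 : (L g + L (x ^+ (N + N)) <=
    maxn (L (x ^+ N) + L (g^-1 * x ^+ N)) (L (x ^+ N) + L (g * x ^+ N)))%N.
  have := tree_four_point 1 g (x ^- N) (x ^+ N).
  have -> : L (g^-1 * x ^- N) = L (g * x ^+ N).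
    by rewrite -tree_lengthV invgM !invgK gN.
  by rewrite invg1 !mul1g invgK tree_lengthV expgnDr.
rewrite tree_lengthX in p1.
have Lg : L g = 0 by lia.
apply: (acyl (p := x ^+ N) Lg); last by lia.
by rewrite /conjg gN mulKg.
Qed.

Lemma busemann_inj g h :
  axis_stab g -> axis_stab h -> busemann g = busemann h -> g = h.
Proof.
move=> Ag Ah e; apply: divg1_eq; apply: busemann_eq0.
  exact: axis_stabM (axis_stabV Ah).
by rewrite busemannM ?busemannV ?e //; [lia | exact: axis_stabV].
Qed.

(** Commutativity is inherited from the integers, into which [busemann] embeds the stabilizer. *)
Lemma axis_stab_commute g h : axis_stab g -> axis_stab h -> commute g h.
Proof.
move=> Ag Ah; apply: busemann_inj; rewrite ?busemannM //; try exact: axis_stabM.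
exact: GRing.addrC.
Qed.

Lemma axis_stabE g : axis_stab g <-> commute x g.
Proof.
split; first exact: axis_stab_commute axis_stab_gen.
by move=> xg; exists 1%N => //; rewrite expg1.
Qed.

Lemma busemannX g k : axis_stab g -> busemann (g ^+ k) = (busemann g *+ k)%R.
Proof.
move=> Ag; suff [] : axis_stab (g ^+ k) /\ busemann (g ^+ k) = (busemann g *+ k)%R.
  by [].
elim: k => [|k [IH1 IH2]].
  rewrite expg0 busemann1; split=> //.
  by rewrite -(mulgV g); exact: axis_stabM (axis_stabV Ag).
by rewrite expgS GRing.mulrS -IH2 -busemannM //; split=> //; exact: axis_stabM.
Qed.

Lemma axis_stabX g k : axis_stab g -> axis_stab (g ^+ k).
Proof. by move=> /axis_stabE xg; apply/axis_stabE; exact: commuteX. Qed.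

(* x ^+ k translates its axis by k * L x, and translation lengths are invariant under
   conjugation. *)
Lemma translation_length_conj g (k l : nat) (b : bool) :
  (x ^+ k) ^ g = (if b then x ^+ l else x ^- l) -> k = l.
Proof.
move=> xg.
(* Conjugation by g changes lengths by at most 2 L g, uniformly in the multiple m of the
   exponents. *)
have bound m : (`|(m * k * n)%N%:Z - (m * l * n)%N%:Z|%R <= (2 * L g)%N%:Z)%R.
  have e : (x ^+ (k * m)) ^ g = (if b then x ^+ (l * m) else x ^- (l * m)).
    by rewrite expgnA conjXg xg; case: (b); rewrite ?expVgn -expgnA.
  have e2 : L ((x ^+ (k * m)) ^ g) = (l * m * n)%N.
    by rewrite e; case: (b); rewrite ?tree_lengthV tree_lengthX.
  have u1 : (L ((x ^+ (k * m)) ^ g) <= L g + L (x ^+ (k * m)) + L g)%N.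
    rewrite /conjg mulgA -{1}(tree_lengthV g); apply: leq_trans (tree_lengthM _ _) _.
    by rewrite leq_add2r tree_lengthM.
  have u2 : (L (x ^+ (k * m)) <= L g + L ((x ^+ (k * m)) ^ g) + L g)%N.
    rewrite -{1}(conjgK g (x ^+ (k * m))) /(conjg _ g^-1) invgK mulgA.
    rewrite -{2}(tree_lengthV g); apply: leq_trans (tree_lengthM _ _) _.
    by rewrite leq_add2r tree_lengthM.
  rewrite e2 !tree_lengthX in u1 u2; nia.
(* For this m, distinct k and l would give lengths differing by at least m * n > 2 L g. *)
move: (bound (2 * L g + 1)%N); set m := (2 * L g + 1)%N => {}bound.
have mn : (m <= m * n)%N by rewrite leq_pmulr.
case: (ltngtP k l) => // kl.
  have : (m * k.+1 * n <= m * l * n)%N by rewrite !leq_mul.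
  by rewrite mulnS mulnDl; lia.
have : (m * l.+1 * n <= m * k * n)%N by rewrite !leq_mul.
by rewrite mulnS mulnDl; lia.
Qed.

Hypothesis no2 : forall g, g * g = 1 -> g = 1.

(** With p = [L x] and q the absolute value of [busemann g], both sides have the same Busemann
    value. *)
Lemma axis_stab_pow g : axis_stab g -> g <> 1 ->
  exists p q (b : bool), [/\ (0 < p)%N, (0 < q)%N
    & g ^+ p = if b then x ^+ q else x ^- q].
Proof.
move=> Ag g1; have bg : busemann g <> 0%R by move/(busemann_eq0 Ag).
exists n, `|busemann g|%N, (0 <= busemann g)%R; split=> //; first by lia.
apply: busemann_inj; first exact: axis_stabX.
  by case: ifP => _; [|apply: axis_stabV]; apply: axis_stabX; exact: axis_stab_gen.
rewrite busemannX //; case: ifP => s.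
  by rewrite busemannX ?busemann_gen; [nia | exact: axis_stab_gen].
rewrite busemannV; last by apply: axis_stabX; exact: axis_stab_gen.
by rewrite busemannX ?busemann_gen; [nia | exact: axis_stab_gen].
Qed.

Lemma conjg_pow_commute g k : (0 < k)%N -> (x ^+ k) ^ g = x ^+ k -> commute x g.
Proof.
move=> k0 e; apply/axis_stabE; exists k => //.
by apply: commute_sym; rewrite /commute conjgC e.
Qed.

(** Powers of u and of u^g are powers of x, so g conjugates some x^k to a power of x, which is x^k
    or x^-k by translation lengths. In the first case g commutes with x. In the second g^2 commutes
    with x^k; unless g = 1, a power of g^2 is then a nontrivial power of x, and g commutes with
    it. *)
Lemma hyperbolic_malnormal u g :
  commute x u -> u <> 1 -> commute x (u ^ g) -> commute x g.
Proof.
move=> /axis_stabE Au u1 /axis_stabE Aug.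
have ug1 : u ^ g <> 1 by move/eqP; rewrite conjg_eq1 => /eqP.
have [p [q [b [p0 q0 up]]]] := axis_stab_pow Au u1.
have [p' [q' [b' [p'0 q'0 ugp]]]] := axis_stab_pow Aug ug1.
have [b1 xg] : exists b1 : bool,
    (x ^+ (q * p')) ^ g = (if b1 then x ^+ (q' * p) else x ^- (q' * p)).
  have e1 : (u ^ g) ^+ (p * p') =
      (if b then (x ^+ (q * p')) ^ g else ((x ^+ (q * p')) ^ g)^-1).
    by rewrite -conjXg expgnA up; case: (b); rewrite ?expVgn -expgnA ?conjVg.
  have e2 : (u ^ g) ^+ (p * p') = (if b' then x ^+ (q' * p) else x ^- (q' * p)).
    by rewrite mulnC expgnA ugp; case: (b'); rewrite ?expVgn -expgnA.
  exists (b == b'); rewrite e1 in e2; case: (b) e2 => [->|]; first by case: (b').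
  by move/(congr1 (@monoid.inv _)); rewrite invgK => ->; case: (b'); rewrite ?invgK.
have k0 : (0 < q * p')%N by rewrite muln_gt0 q0.
have e := translation_length_conj xg; move: xg; rewrite -{}e.
move: (q * p')%N k0 => k k0 {p p' q q' b b' p0 p'0 q0 q'0 up ugp}.
case: b1 => [|xg]; first exact: conjg_pow_commute.
have Agg : axis_stab (g * g).
  have e : (x ^+ k) ^ (g * g) = x ^+ k by rewrite conjgM xg conjVg xg invgK.
  by exists k => //; apply/commute_sym; rewrite /commute (conjgC (x ^+ k)) e.
have [/no2 -> //|gg1] := pselect (g * g = 1); first exact: commute1.
have [p [q [b [p0 q0 ggp]]]] := axis_stab_pow Agg gg1.
apply: (conjg_pow_commute q0).
have gggp : ((g * g) ^+ p) ^ g = (g * g) ^+ p.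
  by rewrite conjXg; congr (_ ^+ _); rewrite /conjg mulgA mulKg.
rewrite ggp in gggp; case: (b) gggp => //.
by rewrite conjVg => /invg_inj.
Qed.

End Hyperbolic.
End TreeLength.

(** * HNN extensions with many stable letters *)

Definition letter : Type := (nat * bool)%type.
HB.instance Definition _ := Countable.on letter.
Definition letter_inv (l : letter) : letter := (l.1, ~~ l.2).

Lemma letter_invK : involutive letter_inv.
Proof. by case=> n b; rewrite /letter_inv /= negbK. Qed.

Lemma letter_inv_neq l : letter_inv l != l.
Proof. by case: l => n []; apply/eqP; case. Qed.

Section HNN.
(** Each letter l, positive or negative, has its own associated subgroup [C l], which l conjugates
    onto that of the inverse letter through [phi l]. Indexing by signed letters treats both
    directions of a stable letter alike. *)
Variables (G : groupType) (C : letter -> set G) (phi : letter -> G -> G).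

Definition hnn_inv (t : G + letter) : G + letter :=
  match t with inl g => inl g^-1 | inr l => inr (letter_inv l) end.

Inductive hnn_rel : seq (G + letter) -> seq (G + letter) -> Prop :=
| hnn_rel_mul a b : hnn_rel [:: inl a; inl b] [:: inl (a * b)]
| hnn_rel_conj l a : C l a -> hnn_rel [:: inl a; inr l] [:: inr l; inl (phi l a)].

Definition hnn : Type := presented_group hnn_inv hnn_rel.
HB.instance Definition _ := Group.on hnn.
Bind Scope group_scope with hnn.

Definition hnn_base (g : G) : hnn := word_class _ _ [:: inl g].
Definition hnn_letter (l : letter) : hnn := word_class _ _ [:: inr l].

Lemma hnn_baseM : {morph hnn_base : a b / a * b}.
Proof.
move=> a b; rewrite /hnn_base -[RHS]word_class_cat /=.
by apply/esym/word_class_rel; constructor.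
Qed.

Lemma hnn_base1 : hnn_base 1 = 1.
Proof. by apply: (mulgI (hnn_base 1)); rewrite -hnn_baseM !mulg1. Qed.

HB.instance Definition _ := isUMagmaMorphism.Build G hnn hnn_base
  (conj hnn_base1 hnn_baseM).

Lemma hnn_base_conjg a b : hnn_base (a ^ b) = hnn_base a ^ hnn_base b.
Proof. exact: gmulfJ. Qed.

Lemma hnn_letterV l : hnn_letter (letter_inv l) = (hnn_letter l)^-1.
Proof. exact: (word_class_inv _ _ (inr l)). Qed.

Lemma hnn_conj l a : C l a ->
  hnn_base a * hnn_letter l = hnn_letter l * hnn_base (phi l a).
Proof.
move=> la; rewrite -[LHS]word_class_cat -[RHS]word_class_cat /=.
by apply: word_class_rel; constructor.
Qed.

Lemma hnn_ind (P : hnn -> Prop) : P 1 ->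
  (forall g x, P x -> P (hnn_base g * x)) ->
  (forall l x, P x -> P (hnn_letter l * x)) -> forall x, P x.
Proof.
move=> P1 Pb Pl x; elim/presented_ind: x => // -[g|l] x Px; first exact: Pb.
exact: Pl.
Qed.

Hypothesis C1 : forall l, C l 1.
Hypothesis CM : forall l a b, C l a -> C l b -> C l (a * b).
Hypothesis CV : forall l a, C l a -> C l a^-1.
Hypothesis phi_mem : forall l a, C l a -> C (letter_inv l) (phi l a).
Hypothesis phiM : forall l a b, C l a -> C l b -> phi l (a * b) = phi l a * phi l b.
Hypothesis phiK : forall l a, C l a -> phi (letter_inv l) (phi l a) = a.

(** * Transversals, normal forms and the action on them *)

Lemma phi1 l : phi l 1 = 1.
Proof. by apply: (mulgI (phi l 1)); rewrite -phiM // !mulg1. Qed.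

(** Representative of the coset g [C l]. The coset [C l] itself is given the representative 1, so
    that a cancellation shows up as a syllable with first component 1. *)
Definition transv l g : G :=
  if `[< C l g >] then 1 else xget 1 [set h | C l (g^-1 * h)].

Lemma transv_mem l g : C l (g^-1 * transv l g).
Proof.
rewrite /transv; case: asboolP => Cg; first by rewrite mulg1; exact: CV.
by apply: (@xgetPex _ 1 [set h | C l (g^-1 * h)]); exists g; rewrite /= mulVg.
Qed.

Lemma transv_eq l g h : C l (g^-1 * h) -> transv l g = transv l h.
Proof.
move=> Cgh; have Chg : C l (h^-1 * g) by have := CV Cgh; rewrite invgM invgK.
rewrite /transv; have -> : `[< C l g >] = `[< C l h >].
  apply: asbool_equiv_eq; split=> H.
    by rewrite -(mulVKg g h); exact: CM.
  by rewrite -(mulVKg h g); exact: CM.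
congr (if _ then _ else xget _ _); rewrite eqEsubset; split=> k /= H.
  by rewrite -(mulVKg g k) mulgA; exact: CM.
by rewrite -(mulVKg h k) mulgA; exact: CM.
Qed.

Lemma transvK l g : transv l (transv l g) = transv l g.
Proof. by apply/esym/transv_eq/transv_mem. Qed.

Lemma transv_in l g : C l g -> transv l g = 1.
Proof. by move=> Cg; rewrite /transv asboolT. Qed.

Lemma transv1 l : transv l 1 = 1.
Proof. exact: transv_in. Qed.

Lemma transv_eq1 l g : transv l g = 1 -> C l g.
Proof. by move=> e; have := CV (transv_mem l g); rewrite e mulg1 invgK. Qed.

Lemma transv_memV l g : C l ((transv l g)^-1 * g).
Proof. by have := CV (transv_mem l g); rewrite invgM invgK. Qed.

(** What comes out to the right of l when the product g l is rewritten as [transv l g] followed by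
    l. *)
Definition carry l g : G := phi l ((transv l g)^-1 * g).

Lemma carry_mem l g : C (letter_inv l) (carry l g).
Proof. exact/phi_mem/transv_memV. Qed.

Lemma carry1 l g : transv l g = g -> carry l g = 1.
Proof. by rewrite /carry => ->; rewrite mulVg phi1. Qed.

Lemma carryM l g h : carry l (g * h) = carry l (g * transv l h) * carry l h.
Proof.
rewrite /carry -phiM; try exact: transv_memV.
congr (phi l _); rewrite -!mulgA mulVKg.
congr (_^-1 * _); apply/esym/transv_eq.
by rewrite invgM mulgA mulgVK; exact: transv_memV.
Qed.

Lemma transvM l g h : transv l (g * transv l h) = transv l (g * h).
Proof. by apply: transv_eq; rewrite invgM mulgA mulgVK; exact: transv_memV. Qed.

(* A syllable (r, l) stands for the product of r, taken in the transversal, and of the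
   letter l; a normal form is a list of syllables followed by an element of G. *)
Definition syllable : Type := (G * letter)%type.
Implicit Types (w : seq syllable) (l : letter) (g h : G).

Fixpoint base_act g w : seq syllable :=
  if w is (r, l) :: w' then (transv l (g * r), l) :: base_act (carry l (g * r)) w'
  else [::].

Fixpoint base_out g w : G :=
  if w is (r, l) :: w' then base_out (carry l (g * r)) w' else g.

Definition starts (s : syllable) w : bool := ohead w == Some s.

Definition letter_act l w : seq syllable :=
  if starts (1, letter_inv l) w then behead w else (1, l) :: w.

(** The excluded pattern, l followed by the syllable (1, [letter_inv l]), is exactly a pinch of
    Britton's lemma, thanks to the choice of 1 in the transversals. *)
Fixpoint normal w : Prop :=
  if w is (r, l) :: w' then
    [/\ transv l r = r, ~~ starts (1, letter_inv l) w' & normal w'] else True.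

Lemma normal_behead s w : normal (s :: w) -> normal w.
Proof. by case: s => r l []. Qed.

Lemma size_base_act g w : size (base_act g w) = size w.
Proof. by elim: w g => //= -[r l] w IH g /=; rewrite IH. Qed.

Lemma base_actM g h w : base_act (g * h) w = base_act g (base_act h w).
Proof.
elim: w g h => //= -[r l] w IH g h /=; rewrite transvM -mulgA -IH.
by rewrite -carryM.
Qed.

Lemma base_outM g h w :
  base_out (g * h) w = base_out g (base_act h w) * base_out h w.
Proof.
by elim: w g h => //= -[r l] w IH g h /=; rewrite -mulgA (carryM l g (h * r)) IH.
Qed.

Lemma base_act1 w : normal w -> base_act 1 w = w.
Proof.
by elim: w => //= -[r l] w IH [rl _ /IH nw] /=; rewrite mul1g carry1 // nw rl.
Qed.

Lemma base_out1 w : normal w -> base_out 1 w = 1.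
Proof.
by elim: w => //= -[r l] w IH [rl _ /IH nw] /=; rewrite mul1g carry1 // nw.
Qed.

Lemma starts_base_act l g w : normal w -> C l g ->
  starts (1, l) (base_act g w) = starts (1, l) w.
Proof.
case: w => //= -[r l'] w [rl _ _] Cg; rewrite /starts /=.
apply/eqP/eqP => -[] e el; subst l'.
  congr (Some (_, _)); rewrite -rl; apply: transv_in.
  by rewrite -(mulKg g r); apply: CM; [exact: CV | exact: transv_eq1].
by rewrite e mulg1 transv_in.
Qed.

Lemma normal_base_act g w : normal w -> normal (base_act g w).
Proof.
elim: w g => //= -[r l] w IH g [rl sw nw]; split; first exact: transvK.
  by rewrite starts_base_act //; exact: carry_mem.
exact: IH.
Qed.

Lemma normal_letter_act l w : normal w -> normal (letter_act l w).
Proof.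
rewrite /letter_act; case: ifP => [_|/negbT sw nw]; last first.
  by split=> //; exact: transv1.
by case: w => //= -[r l'] w [].
Qed.

Lemma letter_actK l w : normal w ->
  letter_act (letter_inv l) (letter_act l w) = w.
Proof.
rewrite {2}/letter_act; case: ifP => [|_ _]; last first.
  by rewrite /letter_act /starts letter_invK /= eqxx.
case: w => // -[r l'] w; rewrite {1}/starts => /eqP[-> ->] [_ /negbTE sw _].
by rewrite /letter_act sw.
Qed.

(** The van der Waerden trick: letting the generators act on normal forms, instead of reducing
    words, yields uniqueness of normal forms without any confluence argument. *)
Definition state_act (t : G + letter) (s : seq syllable * G) :=
  match t with
  | inl g => (base_act g s.1, base_out g s.1 * s.2)
  | inr l => (letter_act l s.1, s.2)
  end.

Definition word_act (u : seq (G + letter)) s := foldr state_act s u.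

Lemma normal_state_act t s : normal s.1 -> normal (state_act t s).1.
Proof. by case: t => [g|l]; [exact: normal_base_act|exact: normal_letter_act]. Qed.

Lemma normal_word_act u s : normal s.1 -> normal (word_act u s).1.
Proof. by move=> ns; elim: u => //= t u IH; exact: normal_state_act. Qed.

Lemma state_actK t s : normal s.1 -> state_act (hnn_inv t) (state_act t s) = s.
Proof.
case: s => w e; case: t => [g|l] /= nw; last by rewrite letter_actK.
by rewrite mulgA -base_actM -base_outM mulVg base_act1 // base_out1 // mul1g.
Qed.

Lemma hnn_invK : involutive hnn_inv.
Proof. by case=> [g|l] /=; rewrite ?invgK ?letter_invK. Qed.

(** This and [letter_out_base] say that the action respects the defining relation for conjugation by
    l. *)
Lemma letter_act_base l a w : normal w -> C l a ->
  base_act a (letter_act l w) = letter_act l (base_act (phi l a) w).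
Proof.
move=> nw Ca; rewrite /letter_act starts_base_act //; last exact: phi_mem.
case: ifP => [|_ /=]; last by rewrite mulg1 /carry transv_in // invg1 mul1g.
case: w nw => //= -[r l'] w; rewrite /starts /= => nw /eqP[er el]; subst r l'.
rewrite mulg1 /carry transv_in; last exact: phi_mem.
by rewrite invg1 mul1g phiK.
Qed.

Lemma letter_out_base l a w : normal w -> C l a ->
  base_out a (letter_act l w) = base_out (phi l a) w.
Proof.
move=> nw Ca; rewrite /letter_act.
case: ifP => [|_ /=]; last by rewrite mulg1 /carry transv_in // invg1 mul1g.
case: w nw => //= -[r l'] w; rewrite /starts /= => nw /eqP[er el]; subst r l'.
rewrite mulg1 /carry transv_in; last exact: phi_mem.
by rewrite invg1 mul1g phiK.
Qed.

Lemma word_act_cong u v s : normal s.1 ->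
  word_cong hnn_inv hnn_rel u v -> word_act u s = word_act v s.
Proof.
move=> ns; elim=> {u v} //.
- by move=> v u w _ -> _ ->.
- move=> u t v; rewrite /word_act !foldr_cat /= -{1}(hnn_invK t) state_actK //.
  exact: normal_word_act.
- move=> u t v; rewrite /word_act !foldr_cat /= state_actK //.
  exact: normal_word_act.
- move=> u r r' v; rewrite /word_act !foldr_cat => rr'; congr (foldr _ _ _).
  have := normal_word_act v ns; rewrite /word_act; move: (foldr _ _ v).
  case=> w e /= nw {u v s ns}; case: rr' => [a b|l a Ca] /=.
    by rewrite base_actM base_outM mulgA.
  by rewrite letter_act_base // letter_out_base.
Qed.

Definition nf (x : hnn) : seq syllable * G := word_act (repr x) ([::], 1).

Lemma nf_class u : nf (word_class _ _ u) = word_act u ([::], 1).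
Proof. exact/word_act_cong/repr_word_class. Qed.

Lemma nf1 : nf 1 = ([::], 1). Proof. exact: nf_class [::]. Qed.

Lemma normal_nf x : normal (nf x).1.
Proof. exact: normal_word_act. Qed.

Lemma nf_cons t x : nf (word_class _ _ [:: t] * x) = state_act t (nf x).
Proof.
by rewrite -{1}(word_class_repr x) -word_class_cat nf_class.
Qed.

Lemma nf_base g x :
  nf (hnn_base g * x) = (base_act g (nf x).1, base_out g (nf x).1 * (nf x).2).
Proof. exact: nf_cons. Qed.

Lemma nf_letter l x : nf (hnn_letter l * x) = (letter_act l (nf x).1, (nf x).2).
Proof. exact: nf_cons. Qed.

Fixpoint nf_val w (e : G) : hnn :=
  if w is (r, l) :: w' then hnn_base r * (hnn_letter l * nf_val w' e)
  else hnn_base e.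

Lemma nf_val_base g w e :
  nf_val (base_act g w) (base_out g w * e) = hnn_base g * nf_val w e.
Proof.
elim: w g e => [|[r l] w IH] g e /=; first exact: hnn_baseM.
rewrite IH; set k := g * r.
have -> : hnn_base g * (hnn_base r * (hnn_letter l * nf_val w e)) =
    hnn_base (transv l k) * (hnn_base ((transv l k)^-1 * k) *
      (hnn_letter l * nf_val w e)).
  by rewrite mulgA -hnn_baseM [RHS]mulgA -hnn_baseM mulVKg.
by congr (_ * _); rewrite [RHS]mulgA (hnn_conj (transv_memV l k)) mulgA.
Qed.

Lemma nf_valK x : nf_val (nf x).1 (nf x).2 = x.
Proof.
elim/hnn_ind: x => [|g x IH|l x IH]; first by rewrite nf1 /= hnn_base1.
  by rewrite nf_base nf_val_base IH.
rewrite nf_letter /= -{3}IH /letter_act; case: ifP => [|_] /=.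
  case: (nf x).1 => //= -[r l'] w; rewrite /starts /= => /eqP[-> ->].
  by rewrite hnn_base1 mul1g hnn_letterV mulVKg.
by rewrite hnn_base1 mul1g.
Qed.

Lemma nf_valE w e : normal w -> nf (nf_val w e) = (w, e).
Proof.
elim: w => [_|[r l] w IH [rl sw nw]] /=.
  by rewrite -(mulg1 (hnn_base e)) nf_base nf1 /= mulg1.
rewrite nf_base nf_letter IH //= /letter_act (negbTE sw) /= mulg1 rl carry1 //.
by rewrite base_act1 // base_out1 // mul1g.
Qed.

Lemma nf_of_base g : nf (hnn_base g) = ([::], g).
Proof. by rewrite -(nf_valE g (w := [::])). Qed.

Lemma hnn_base_inj : injective hnn_base.
Proof. by move=> g h /(congr1 nf); rewrite !nf_of_base => -[]. Qed.

(** * Length and Gromov product on the HNN extension *)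

Fixpoint lcp w v : nat :=
  match w, v with
  | a :: w', b :: v' => if a == b then (lcp w' v').+1 else 0
  | _, _ => 0
  end.

Lemma lcp_ultra w v u : (minn (lcp w u) (lcp u v) <= lcp w v)%N.
Proof.
elim: w u v => [|a w IH] [|b u] [|d v] //=; rewrite ?minn0 ?min0n //.
have [<-|] := eqVneq a b; last by rewrite min0n.
by have [_|] := eqVneq a d; rewrite ?minn0 // minnSS ltnS.
Qed.

Lemma lcp_starts s w v : ~~ starts s w -> lcp w (s :: v) = 0.
Proof.
case: w => //= a w; rewrite /starts /= => /eqP as_; case: eqP => // e.
by case: as_; rewrite e.
Qed.

Lemma starts_base_actV r l w : transv l r = r -> normal w ->
  starts (1, l) (base_act r^-1 w) = starts (r, l) w.
Proof.
move=> rl; case: w => //= -[r' l'] w [rl' _ _]; rewrite /starts /=.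
apply/eqP/eqP => -[e el]; subst l'; last by rewrite e mulVg transv1.
by congr (Some (_, _)); rewrite -rl -rl'; apply/esym/transv_eq/transv_eq1.
Qed.

(** The syllables of x are the edges of the geodesic of the Bass-Serre tree from the base vertex to
    its image under x; the final element of G fixes the base vertex and is dropped. *)
Definition hnn_length (x : hnn) : nat := size (nf x).1.
Definition hnn_prefix (x y : hnn) : nat := lcp (nf x).1 (nf y).1.

Lemma hnn_length_base g x : hnn_length (hnn_base g * x) = hnn_length x.
Proof. by rewrite /hnn_length nf_base size_base_act. Qed.

Lemma hnn_length_val w e : normal w -> hnn_length (nf_val w e) = size w.
Proof. by move=> nw; rewrite /hnn_length nf_valE. Qed.

Lemma hnn_length1 : hnn_length 1 = 0.
Proof. by rewrite /hnn_length nf1. Qed.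

Lemma hnn_length_eq0 x : hnn_length x = 0 -> exists g, x = hnn_base g.
Proof.
move/size0nil => e; exists (nf x).2.
by rewrite -[LHS]nf_valK e.
Qed.

(** Strip the first syllable (r, l) of w: either y starts with it too and it cancels, or the inverse
    letter is added in front of y and the common prefix is empty. *)
Lemma hnn_length_valV w e y : normal w ->
  (hnn_length ((nf_val w e)^-1 * y) + 2 * lcp w (nf y).1 =
    size w + hnn_length y)%N.
Proof.
elim: w y => [|[r l] w IH] y.
  by move=> _ /=; rewrite -gmulfV hnn_length_base addn0.
move=> [rl sw nw].
have -> : (nf_val ((r, l) :: w) e)^-1 * y =
    (nf_val w e)^-1 * (hnn_letter (letter_inv l) * (hnn_base r^-1 * y)).
  by rewrite /= !invgM -!mulgA hnn_letterV gmulfV.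
have {IH} := IH (hnn_letter (letter_inv l) * (hnn_base r^-1 * y)) nw.
rewrite /hnn_length nf_letter nf_base [(_, _).1]/=.
rewrite /letter_act letter_invK starts_base_actV //; last exact: normal_nf.
case: ifP (normal_nf y) => [|/negbT] sy ny.
  case: (nf y).1 sy ny => // s v /eqP[->] /= [_ _ nv].
  rewrite mulVg (carry1 (transv1 l)) base_act1 // eqxx => *; lia.
rewrite lcp_starts //= size_base_act.
case: (nf y).1 sy {ny} => [|s v]; first by move=> *; lia.
rewrite /starts /= => /eqP sr; case: eqP => [e'|_]; first by case: sr; rewrite e'.
by move=> *; lia.
Qed.

Lemma hnn_length_prefix x y :
  (hnn_length (x^-1 * y) + 2 * hnn_prefix x y = hnn_length x + hnn_length y)%N.
Proof.
by have := hnn_length_valV (nf x).2 y (normal_nf x); rewrite nf_valK.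
Qed.

Lemma hnn_prefix_ultra x y z :
  (minn (hnn_prefix x z) (hnn_prefix z y) <= hnn_prefix x y)%N.
Proof. exact: lcp_ultra. Qed.

Lemma hnn_baseJ l a : C l a -> hnn_base a ^ hnn_letter l = hnn_base (phi l a).
Proof. by move=> la; rewrite /conjg hnn_conj // mulKg. Qed.

(** Here h fixes both ends of the path described by x, hence its first edge, which is the membership
    in [C l]. Conjugating by the first syllable leaves the same situation on a shorter path, so the
    lemma can be iterated. *)
Lemma hnn_length_conj_base h x r l w :
  (nf x).1 = (r, l) :: w -> hnn_length (hnn_base h ^ x) = 0 ->
  C l (h ^ r) /\
  hnn_base h ^ x = hnn_base (phi l (h ^ r)) ^ nf_val w (nf x).2.
Proof.
move=> ex Lh; have Lx : hnn_length x = (size w).+1 by rewrite /hnn_length ex.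
have p : (0 < hnn_prefix x (hnn_base h * x))%N.
  have := hnn_length_prefix x (hnn_base h * x).
  by rewrite -/(conjg _ _) Lh hnn_length_base Lx => *; lia.
have rh : transv l (h * r) = r.
  by move: p; rewrite /hnn_prefix nf_base ex /=; case: eqP => // -[].
have Ch : C l (h ^ r) by have := transv_memV l (h * r); rewrite rh.
split=> //.
have {1}-> : x = hnn_base r * (hnn_letter l * nf_val w (nf x).2).
  by rewrite -{1}(nf_valK x) ex.
by rewrite !conjgM -hnn_base_conjg hnn_baseJ.
Qed.

Lemma hnn_length_letter r l : hnn_length (hnn_base r * hnn_letter l) = 1%N.
Proof.
by rewrite hnn_length_base -(mulg1 (hnn_letter l)) /hnn_length nf_letter nf1.
Qed.

(** If the length of x * x drops, then x and x^-1 begin with a common syllable (r, l), and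
    conjugation by r l shortens x. *)
Lemma hnn_cyclic_reduction x : (0 < hnn_length x)%N ->
  hnn_length (x * x) <> (2 * hnn_length x)%N ->
  exists y : hnn, (hnn_length (x ^ y) < hnn_length x)%N.
Proof.
move=> x0 xx.
have LV := tree_lengthV hnn_length1 hnn_length_prefix.
have : (0 < hnn_prefix x^-1 x)%N.
  have : (hnn_length (x * x) + 2 * hnn_prefix x^-1 x =
      hnn_length x + hnn_length x)%N.
    by rewrite -{1}(invgK x) hnn_length_prefix LV.
  by move=> *; lia.
rewrite /hnn_prefix.
case ex : (nf x).1 => [|[r l] w]; first by case: (nf x^-1).1.
case ex' : (nf x^-1).1 => [|[r' l'] w'] //=.
case: eqP => // -[er el] _; subst r' l'.
pose a := hnn_base r * hnn_letter l.
have La : hnn_length a = 1%N := hnn_length_letter r l.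
have xa : x = a * nf_val w (nf x).2 by rewrite -{1}(nf_valK x) ex -mulgA.
have xVa : x^-1 = a * nf_val w' (nf x^-1).2 by rewrite -{1}(nf_valK x^-1) ex' -mulgA.
have nw : normal w by have := normal_nf x; rewrite ex => -[].
have nw' : normal w' by have := normal_nf x^-1; rewrite ex' => -[].
have Lw := hnn_length_val (nf x).2 nw; have Lw' := hnn_length_val (nf x^-1).2 nw'.
have Lx : hnn_length x = (size w).+1 by rewrite /hnn_length ex.
have sw' : size w' = size w.
  by have := LV x; rewrite Lx /hnn_length ex' /= => -[].
(* In length 1, x^-1 begins with the inverse of l and x with l: the action has no inversions. *)
case: w ex xa nw Lw Lx sw' => [|s w] ex xa nw Lw Lx sw'.
  have : (nf x^-1).1 = [:: (transv (letter_inv l) (nf x).2^-1, letter_inv l)].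
    have -> : x^-1 = hnn_base (nf x).2^-1 *
        (hnn_letter (letter_inv l) * hnn_base r^-1).
      by rewrite {1}xa /a /= !invgM !gmulfV hnn_letterV.
    by rewrite nf_base nf_letter nf_of_base /letter_act /= mulg1.
  by rewrite ex' => -[_ e]; have := letter_inv_neq l; rewrite -e eqxx.
exists a.
have Lxa : hnn_length (x * a) = (size w).+1.
  by rewrite -LV invgM xVa mulKg Lw' sw'.
(* The prefix of x is shared with a and with x * a, so by the ultrametric inequality a and x * a
   share a syllable, and the length of x ^ a is at most that of x minus 2. *)
have p1 := hnn_length_prefix a x; rewrite {1}xa mulKg Lw La Lx /= in p1.
have p2 := hnn_length_prefix x (x * a); rewrite mulKg La Lxa Lx /= in p2.
have p3 := hnn_length_prefix a (x * a); rewrite -/(conjg _ _) La Lxa in p3.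
have p4 := hnn_prefix_ultra a (x * a) x.
by rewrite Lx /=; lia.
Qed.

Lemma phi_neq1 l a : C l a -> a <> 1 -> phi l a <> 1.
Proof. by move=> la a1 e; apply: a1; rewrite -(phiK la) e phi1. Qed.

Lemma conjg_neq1 a g : a <> 1 -> a ^ g <> 1.
Proof. by move=> a1 /eqP; rewrite conjg_eq1 => /eqP. Qed.

(** * Malnormal edge groups and acylindricity *)

Section Tame.
Variable M : set G.
Hypothesis M_malnormal : forall a g, M a -> a <> 1 -> M (a ^ g) -> M g.
Hypothesis C_falseM : forall i a, C (i, false) a -> M a.
Hypothesis C_true_malnormal : forall i j a g,
  C (i, true) a -> a <> 1 -> C (j, true) (a ^ g) -> i = j /\ C (i, true) g.
Hypothesis C_trueM : forall i a g, C (i, true) a -> a <> 1 -> ~ M (a ^ g).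
Hypothesis G_no2 : forall g, g * g = 1 -> g = 1.

(** After a negative letter the element lies in [C (i, true)]. It cannot cross another negative
    letter, since no conjugate of it lies in M; crossing a positive one forces that letter to be (i,
    true) and r' = 1, which is a cancellation. *)
Lemma no_false_path i a r r' l' w : C (i, false) a -> a <> 1 ->
  normal ((r, (i, false)) :: (r', l') :: w) ->
  ~ C l' (phi (i, false) a ^ r').
Proof.
move=> Ca a1 /= [_ sw [r'l' _ _]]; have Cb := phi_mem Ca.
have b1 := phi_neq1 Ca a1.
case: l' r'l' sw => j [] r'j sw Cb'; last exact: (C_trueM Cb b1) (C_falseM Cb').
have [ij Cr'] := C_true_malnormal Cb b1 Cb'; subst j.
by move: sw; rewrite -r'j (transv_in Cr') /starts eqxx.
Qed.

(** A nontrivial element that crosses a positive letter lands in M and cannot cross a positive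
    letter next; after a negative letter it crosses nothing. So a fixed path is at most a positive
    letter followed by a negative one. *)
Lemma hnn_acylindrical (h x : hnn) : hnn_length h = 0 ->
  hnn_length (h ^ x) = 0 -> (3 <= hnn_length x)%N -> h = 1.
Proof.
move=> /hnn_length_eq0[a ->] Lax Lx.
have [->|/eqP a1] := eqVneq a 1; first exact: hnn_base1.
exfalso; move: Lx; rewrite {1}/hnn_length.
case ex : (nf x).1 => [|[r1 l1] [|[r2 l2] [|[r3 l3] w]]] // _.
have n1 := normal_nf x; rewrite ex in n1.
have n2 := normal_behead n1; have n3 := normal_behead n2.
have [C1a e1] := hnn_length_conj_base ex Lax.
have a1r := conjg_neq1 (g := r1) a1.
rewrite e1 in Lax.
have ex2 := congr1 fst (nf_valE (nf x).2 n2).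
have [C2a e2] := hnn_length_conj_base ex2 Lax.
have b1 := phi_neq1 C1a a1r; have b1r := conjg_neq1 (g := r2) b1.
case: l1 C1a C2a n1 b1 b1r e1 e2 Lax ex
  => i [] C1a C2a n1 b1 b1r e1 e2 Lax ex; last first.
  exact: no_false_path C1a a1r n1 C2a.
case: l2 C2a n1 n2 ex2 e1 e2 Lax ex => j [] C2a n1 n2 ex2 e1 e2 Lax ex.
  apply: (C_trueM C2a b1r (g := r2^-1)); rewrite conjgK.
  exact: C_falseM (phi_mem C1a).
rewrite e2 nf_valE // [(_, _).2]/= in Lax.
have ex3 := congr1 fst (nf_valE (nf x).2 n3).
have [C3a e3] := hnn_length_conj_base ex3 Lax.
exact: no_false_path C2a b1r n2 C3a.
Qed.

(** An element of M cannot cross a positive letter. If it crosses a negative one, the path stops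
    there, at an element not conjugate into M. Hence x has length 0 and malnormality in G
    applies. *)
Lemma hnn_malnormal a a' (x : hnn) : M a -> a <> 1 -> M a' ->
  hnn_base a ^ x = hnn_base a' -> exists2 g, M g & x = hnn_base g.
Proof.
move=> Ma a1 Ma' ax.
have Lax : hnn_length (hnn_base a ^ x) = 0 by rewrite ax /hnn_length nf_of_base.
case ex : (nf x).1 => [|[r1 l1] w].
  have xe : x = hnn_base (nf x).2 by rewrite -{1}(nf_valK x) ex.
  exists (nf x).2 => //; apply: M_malnormal Ma a1 _.
  by have -> : a ^ (nf x).2 = a' by apply: hnn_base_inj; rewrite hnn_base_conjg -xe.
have n1 := normal_nf x; rewrite ex in n1.
have [C1a e1] := hnn_length_conj_base ex Lax.
have a1r := conjg_neq1 (g := r1) a1.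
case: l1 C1a n1 e1 ex => i [] C1a n1 e1 ex.
  by case: (C_trueM C1a a1r (g := r1^-1)); rewrite conjgK.
have b1 := phi_neq1 C1a a1r.
case: w n1 ex e1 => [|[r2 l2] w] n1 ex e1.
  case: (C_trueM (phi_mem C1a) b1 (g := (nf x).2)).
  by move: e1; rewrite ax /= -hnn_base_conjg => /hnn_base_inj <-.
have n2 := normal_behead n1; rewrite e1 in Lax.
have ex2 := congr1 fst (nf_valE (nf x).2 n2).
have [C2a _] := hnn_length_conj_base ex2 Lax.
by have := no_false_path C1a a1r n1 C2a.
Qed.

Lemma hnn_conj_min (x : hnn) : exists y : hnn, forall z : hnn,
  (hnn_length (x ^ y) <= hnn_length ((x ^ y) ^ z))%N.
Proof.
have ex : exists n, `[< exists y : hnn, hnn_length (x ^ y) = n >].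
  by exists (hnn_length x); apply/asboolP; exists 1; rewrite conjg1.
case: (ex_minnP ex) => n /asboolP[y <-] ymin; exists y => z.
by apply: ymin; apply/asboolP; exists (y * z); rewrite conjgM.
Qed.

(** A conjugate of minimal length is either in the base or cannot be cyclically reduced. *)
Lemma hnn_hyperbolic_or_base (x : hnn) : exists y : hnn,
  (exists g, x ^ y = hnn_base g) \/
  (0 < hnn_length (x ^ y))%N /\
  hnn_length (x ^ y * x ^ y) = (2 * hnn_length (x ^ y))%N.
Proof.
have [y ymin] := hnn_conj_min x; exists y.
have [/hnn_length_eq0|L0] := posnP (hnn_length (x ^ y)); first by left.
right; split=> //; apply: contrapT => /(hnn_cyclic_reduction L0)[z].
by rewrite ltnNge ymin.
Qed.

Lemma hnn_no2 (x : hnn) : x * x = 1 -> x = 1.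
Proof.
move=> xx; have [y xy] := hnn_hyperbolic_or_base x.
have xyxy : x ^ y * x ^ y = 1 by rewrite -conjMg xx conj1g.
suff /eqP : x ^ y = 1 by rewrite conjg_eq1 => /eqP.
case: xy => [[g xg]|[L0]]; last by rewrite xyxy hnn_length1; lia.
rewrite xg in xyxy *; rewrite (G_no2 (g := g)) ?hnn_base1 //.
by apply: hnn_base_inj; rewrite hnn_baseM hnn_base1.
Qed.

End Tame.
End HNN.

(** * The inductive step *)

(** An embedding of the centralizer of x into the rationals, encoded as a total function whose
    values elsewhere are arbitrary. *)
Definition centralizer_chart (G : groupType) (x : G) (chi : G -> rat_group) : Prop :=
  (forall u v, commute x u -> commute x v -> chi (u * v) = chi u * chi v) /\
  (forall u v, commute x u -> commute x v -> chi u = chi v -> u = v).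

Definition centralizer_malnormal (G : groupType) (x : G) : Prop :=
  forall u g, commute x u -> u <> 1 -> commute x (u ^ g) -> commute x g.

Definition conj_into (G : groupType) (M : set G) (x : G) : Prop :=
  exists g, M (x ^ g).

(** The invariant of the induction. The enumeration indexes the stable letters of the next step, and
    the charts supply the isomorphisms along which these letters conjugate centralizers into the
    rationals. *)
Record tower_group : Type := TowerGroup {
  tower_sort :> groupType;
  tower_mu : UMagmaMorphism.type rat_group tower_sort;
  tower_enum : nat -> tower_sort;
  tower_mu_inj : injective tower_mu;
  tower_enum_surj : forall x, exists n, tower_enum n = x;
  tower_malnormal : forall a g : tower_sort, range tower_mu a -> a <> 1 ->
    range tower_mu (a ^ g) -> range tower_mu g;
  tower_no2 : forall g : tower_sort, g * g = 1 -> g = 1;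
  tower_centralizer : forall x : tower_sort, ~ conj_into (range tower_mu) x ->
    centralizer_malnormal x /\ exists chi, centralizer_chart x chi }.

Lemma rat_group_mulC (a b : rat_group) : a * b = b * a.
Proof. exact: GRing.addrC. Qed.

Lemma commuteJ (G : groupType) (x y g : G) : commute x y -> commute (x ^ g) (y ^ g).
Proof. by rewrite /commute -!conjMg => ->. Qed.

Lemma commute_conjg (G : groupType) (x y : G) : commute x y -> x ^ y = x.
Proof. by rewrite /conjg => ->; rewrite mulKg. Qed.

Lemma centralizer_conj (G : groupType) (x g : G) :
  (centralizer_malnormal (x ^ g) /\ exists chi, centralizer_chart (x ^ g) chi) ->
  centralizer_malnormal x /\ exists chi, centralizer_chart x chi.
Proof.
move=> [mal [chi [cM cI]]]; split.
  move=> u h xu u1 xuh; rewrite -(conjgK g x) -(conjgK g h); apply: commuteJ.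
  apply: (mal (u ^ g)); first exact: commuteJ.
    by move/eqP; rewrite conjg_eq1 => /eqP.
  by rewrite -conjJg; exact: commuteJ.
exists (fun u => chi (u ^ g)); split=> u v xu xv.
  by rewrite conjMg cM //; exact: commuteJ.
by move/cI => /(_ (commuteJ _ xu) (commuteJ _ xv)) /conjg_inj.
Qed.

Section Step.
Variable T : tower_group.
Local Notation mu := (@tower_mu T).
Local Notation e := (@tower_enum T).
Local Notation M := (range mu).
Implicit Types (x u v g : T) (n i j : nat).

Definition exotic x : Prop := ~ conj_into M x.

(* The centralizer of the j-th element gets conjugated into M unless this happens
   already, or an earlier element has a conjugate centralizer. *)
Definition active j : Prop := exotic (e j) /\
  forall i, (i < j)%N -> exotic (e i) -> ~ exists g, commute (e i ^ g) (e j).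

Definition charts x : set (T -> rat_group) := [set chi | centralizer_chart x chi].
Definition chart x : T -> rat_group := xget (fun=> 1) (charts x).

Lemma chartP x : exotic x -> centralizer_chart x (chart x).
Proof.
by move=> /tower_centralizer[_ ex]; exact: (@xgetPex _ _ (charts x)).
Qed.

Lemma chart1 x : chart x 1 = 1.
Proof.
rewrite /chart; have [ex|nex] := pselect (exists chi, centralizer_chart x chi).
  have [cM _] := @xgetPex _ (fun=> 1) (charts x) ex.
  apply: (mulgI (xget (fun=> 1) (charts x) 1)).
  by rewrite -cM ?mulg1 //; exact: commute1.
by rewrite xgetPN // => chi hchi; apply: nex; exists chi.
Qed.

Lemma exotic_abelian x u v : exotic x -> commute x u -> commute x v -> commute u v.
Proof.
move=> /chartP[cM cI] xu xv; apply: cI; try exact: commuteM.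
by rewrite !cM // rat_group_mulC.
Qed.

Lemma exotic_malnormal x u g : exotic x ->
  commute x u -> u <> 1 -> commute x (u ^ g) -> commute x g.
Proof. by move=> /tower_centralizer[+ _]; apply. Qed.

Lemma range_mu1 : M 1.
Proof. by exists 1 => //; exact: gmulf1. Qed.

Lemma exotic_neq1 x : exotic x -> x <> 1.
Proof. by move=> Ex x1; apply: Ex; exists 1; rewrite x1 conj1g; exact: range_mu1. Qed.

Lemma exotic_commute_trans x u v : exotic x -> u <> 1 ->
  commute x u -> commute u v -> commute x v.
Proof.
move=> Ex u1 xu uv; apply: (exotic_malnormal Ex xu u1).
by rewrite commute_conjg.
Qed.

(** The letter of index 2j serves the j-th element. Odd letters, and even ones whose element is not
    active, get the trivial subgroup and are therefore free. *)
Definition active_sub n : set T :=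
  [set u | u = 1 \/ [/\ ~~ odd n, active n./2 & commute (e n./2) u]].

Definition chart_mu n u : T := mu (chart (e n./2) u).

Definition step_sub (l : letter) : set T :=
  if l.2 then active_sub l.1 else [set chart_mu l.1 u | u in active_sub l.1].

Definition step_phi (l : letter) (u : T) : T :=
  if l.2 then chart_mu l.1 u
  else xget 1 [set v | active_sub l.1 v /\ chart_mu l.1 v = u].

Lemma active_subM n u v : active_sub n u -> active_sub n v -> active_sub n (u * v).
Proof.
case=> [->|[on an xu]]; first by rewrite mul1g.
case=> [->|[_ _ xv]]; first by rewrite mulg1; right.
by right; split=> //; exact: commuteM.
Qed.

Lemma active_subV n u : active_sub n u -> active_sub n u^-1.
Proof.
case=> [->|[on an xu]]; first by left; rewrite invg1.
by right; split=> //; exact: commuteV.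
Qed.

Lemma chart_mu1 n : chart_mu n 1 = 1.
Proof. by rewrite /chart_mu chart1; exact: gmulf1. Qed.

Lemma chart_muM n u v : active_sub n u -> active_sub n v ->
  chart_mu n (u * v) = chart_mu n u * chart_mu n v.
Proof.
case=> [->|[on [/chartP[cM _] _] xu]]; first by rewrite mul1g chart_mu1 mul1g.
case=> [->|[_ _ xv]]; first by rewrite mulg1 chart_mu1 mulg1.
by rewrite /chart_mu cM //; exact: gmulfM.
Qed.

Lemma chart_mu_inj n u v : active_sub n u -> active_sub n v ->
  chart_mu n u = chart_mu n v -> u = v.
Proof.
move=> nu nv /tower_mu_inj uv; case: (nu) => [u1|[on [/chartP[_ cI] _] xu]].
  case: (nv) => [->//|[on [/chartP[_ cI] _] xv]].
  by apply: cI => //; rewrite u1; exact: commute1.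
case: (nv) => [v1|[_ _ xv]]; last exact: cI.
by apply: cI => //; rewrite v1; exact: commute1.
Qed.

Lemma step_sub1 l : step_sub l 1.
Proof.
case: l => n []; first by left.
by exists 1; [left | exact: chart_mu1].
Qed.

Lemma step_subM l u v : step_sub l u -> step_sub l v -> step_sub l (u * v).
Proof.
case: l => n []; first exact: active_subM.
move=> [a na <-] [b nb <-]; exists (a * b); first exact: active_subM.
exact: chart_muM.
Qed.

Lemma chart_muV n u : active_sub n u -> chart_mu n u^-1 = (chart_mu n u)^-1.
Proof.
move=> nu; apply: (mulgI (chart_mu n u)).
by rewrite -chart_muM ?mulgV ?chart_mu1 //; exact: active_subV.
Qed.

Lemma step_subV l u : step_sub l u -> step_sub l u^-1.
Proof.
case: l => n []; first exact: active_subV.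
move=> [a na <-]; exists a^-1; first exact: active_subV.
exact: chart_muV.
Qed.

Lemma step_phi_false n u : active_sub n u -> step_phi (n, false) (chart_mu n u) = u.
Proof.
move=> nu; rewrite /step_phi /=.
set S := [set _ | _]; have [nv e] : S (xget 1 S) by apply: xgetPex; exists u.
exact: chart_mu_inj e.
Qed.

Lemma step_phi_mem l u : step_sub l u -> step_sub (letter_inv l) (step_phi l u).
Proof.
case: l => n []; first by move=> nu; exists u.
by move=> [a na <-]; rewrite step_phi_false.
Qed.

Lemma step_phiM l u v : step_sub l u -> step_sub l v ->
  step_phi l (u * v) = step_phi l u * step_phi l v.
Proof.
case: l => n []; first exact: chart_muM.
move=> [a na <-] [b nb <-]; rewrite -chart_muM // !step_phi_false //.
exact: active_subM.
Qed.

Lemma step_phiK l u : step_sub l u -> step_phi (letter_inv l) (step_phi l u) = u.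
Proof.
case: l => n []; first exact: step_phi_false.
by move=> [a na <-]; rewrite step_phi_false.
Qed.

Lemma step_sub_falseM n u : step_sub (n, false) u -> M u.
Proof. by move=> [a _ <-]; exists (chart (e n./2) a). Qed.

(** By transitivity of commutation through u^g, the conjugate by g of the element of index i
    commutes with that of index j. Activity selects one index per conjugacy class of centralizers,
    so the indices agree, and malnormality of the centralizer locates g. *)
Lemma step_sub_true_malnormal i j u g : step_sub (i, true) u -> u <> 1 ->
  step_sub (j, true) (u ^ g) -> i = j /\ step_sub (i, true) g.
Proof.
move=> [//|[oi [Ei mi] xu]] u1.
have ug1 : u ^ g <> 1 by move/eqP; rewrite conjg_eq1 => /eqP.
move=> [//|[oj [Ej mj] yug]].
have xy : commute (e i./2 ^ g) (e j./2).
  apply/commute_sym/(exotic_commute_trans Ej ug1) => //.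
  exact/commuteJ/commute_sym.
have [ij|ji|ij] := ltngtP i./2 j./2.
- by case: (mj _ ij Ei); exists g.
- case: (mi _ ji Ej); exists g^-1.
  by rewrite -(conjgK g (e i./2)); apply/commuteJ/commute_sym.
have eij : i = j.
  by rewrite -(odd_double_half i) -(odd_double_half j) (negbTE oi) (negbTE oj) ij.
split=> //; right; split=> //.
by subst j; exact: exotic_malnormal xu u1 yug.
Qed.

(** Otherwise the element centralized by u would have its conjugate by g commuting with a nontrivial
    element of M, hence lying in M. *)
Lemma step_sub_trueM i u g : step_sub (i, true) u -> u <> 1 -> ~ M (u ^ g).
Proof.
move=> [//|[oi [Ei mi] xu]] u1 Mug; apply: Ei; exists g.
apply: (tower_malnormal Mug); first by move/eqP; rewrite conjg_eq1 => /eqP.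
by rewrite commute_conjg //; exact/commuteJ/commute_sym.
Qed.

Definition step_group : groupType := hnn step_sub step_phi.
Local Notation base := (hnn_base step_sub step_phi).
Local Notation stable := (hnn_letter step_sub step_phi).
Bind Scope group_scope with step_group.

Lemma step_absorbs x : exists y : step_group, exists2 m, M m & base x ^ y = base m.
Proof.
have [Ex|/contrapT[g Mg]] := pselect (exotic x); last first.
  by exists (base g), (x ^ g) => //; rewrite hnn_base_conjg.
(* The least index of an exotic element with a conjugate commuting with x is active, and its letter
   conjugates a conjugate of x into M. *)
have ex : exists i, `[< exotic (e i) /\ exists g, commute (e i ^ g) x >].
  have [i ix] := tower_enum_surj x; exists i; apply/asboolP; rewrite ix.
  by split=> //; exists 1; rewrite conjg1; exact: commute_refl.
case: (ex_minnP ex) => i /asboolP[Ei [g eix]] imin.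
have Ai : active i.
  split=> // k ki Ek [h eki].
  suff /imin : `[< exotic (e k) /\ exists g, commute (e k ^ g) x >].
    by rewrite leqNgt ki.
  apply/asboolP; split=> //; exists (h * g); rewrite conjgM.
  apply/commute_sym/(exotic_commute_trans (u := e i ^ g) Ex).
  - by move/eqP; rewrite conjg_eq1 => /eqP /(exotic_neq1 Ei).
  - exact: commute_sym.
  - exact/commuteJ/commute_sym.
have Cx : step_sub (i.*2, true) (x ^ g^-1).
  right; rewrite /= odd_double doubleK; split=> //.
  by rewrite -(conjgK g (e i)); exact: commuteJ.
exists (base g^-1 * stable (i.*2, true)), (step_phi (i.*2, true) (x ^ g^-1)).
  exact: (step_sub_falseM (step_phi_mem Cx)).
by rewrite conjgM -hnn_base_conjg hnn_baseJ.
Qed.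

Definition step_mu_fun : rat_group -> step_group := base \o mu.
Lemma step_mu_fun_morphism : monoid_morphism step_mu_fun.
Proof.
split; first by rewrite /step_mu_fun /= gmulf1 hnn_base1.
by move=> a b; rewrite /step_mu_fun /= gmulfM hnn_baseM.
Qed.
HB.instance Definition _ :=
  isUMagmaMorphism.Build rat_group step_group step_mu_fun step_mu_fun_morphism.
Definition step_mu : UMagmaMorphism.type rat_group step_group := step_mu_fun.

Lemma step_mu_inj : injective step_mu.
Proof.
apply: inj_comp (@tower_mu_inj T); apply: hnn_base_inj.
- exact: step_sub1.
- exact: step_subM.
- exact: step_subV.
- exact: step_phi_mem.
- exact: step_phiM.
- exact: step_phiK.
Qed.

Definition decode_letter (t : nat + letter) : T + letter :=
  match t with inl n => inl (e n) | inr l => inr l end.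

Definition step_enum (n : nat) : step_group :=
  word_class _ _ (map decode_letter (odflt [::] (unpickle n))).

Lemma step_enum_surj (y : step_group) : exists n, step_enum n = y.
Proof.
have [w wy] : exists w, map decode_letter w = repr y.
  elim: (repr y) => [|t w [v vw]]; first by exists [::].
  have [t' tt'] : exists t', decode_letter t' = t.
    case: t => [x|l]; last by exists (inr l).
    by have [n <-] := tower_enum_surj x; exists (inl n).
  by exists (t' :: v); rewrite /= tt' vw.
by exists (pickle w); rewrite /step_enum pickleK /= wy; exact: word_class_repr.
Qed.

Lemma range_step_mu (y : step_group) :
  range step_mu y <-> exists2 m, M m & y = base m.
Proof.
split=> [[a _ <-]|[m [a _ <-] ->]]; last by exists a.
by exists (mu a) => //; exists a.
Qed.

Lemma step_malnormal (y g : step_group) : range step_mu y -> y <> 1 ->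
  range step_mu (y ^ g) -> range step_mu g.
Proof.
move=> /range_step_mu[m Mm ->] m1 /range_step_mu[m' Mm' mg].
apply/range_step_mu.
apply: (hnn_malnormal step_sub1 step_subM step_subV
  step_phi_mem step_phiM step_phiK (@tower_malnormal T)
  step_sub_falseM step_sub_true_malnormal step_sub_trueM
  Mm _ Mm' mg).
by move=> m_1; apply: m1; rewrite m_1 hnn_base1.
Qed.

Lemma step_no2 (y : step_group) : y * y = 1 -> y = 1.
Proof.
exact: (hnn_no2 step_sub1 step_subM step_subV
  step_phi_mem step_phiM step_phiK (@tower_no2 T)).
Qed.

(** The chart is the Busemann cocycle, with the integers viewed inside the rationals. *)
Lemma step_hyperbolic (y : step_group) :
  (0 < hnn_length y)%N -> hnn_length (y * y) = (2 * hnn_length y)%N ->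
  centralizer_malnormal y /\ exists chi, centralizer_chart y chi.
Proof.
pose L1 := hnn_length1 step_sub1 step_subM step_subV
  step_phi_mem step_phiM step_phiK.
pose Lc := hnn_length_prefix step_sub1 step_subM step_subV
  step_phi_mem step_phiM step_phiK.
pose Lu := @hnn_prefix_ultra _ step_sub step_phi.
pose acyl := hnn_acylindrical step_sub1 step_subM step_subV
  step_phi_mem step_phiM step_phiK
  step_sub_falseM step_sub_true_malnormal step_sub_trueM.
move=> y0 yy; split.
  by move=> u g; exact: (hyperbolic_malnormal L1 Lc Lu
    y0 yy acyl step_no2).
pose b := busemann L1 Lc Lu y0 yy.
have stabE := axis_stabE L1 Lc Lu y0 yy acyl.
exists (fun p => ((b p)%:~R)%R : rat_group); split=> p q /stabE Ap /stabE Aq.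
  rewrite /b (busemannM L1 Lc Lu y0 yy Ap Aq).
  by rewrite intrD.
move=> /intr_inj; exact: busemann_inj.
Qed.

Lemma step_centralizer (y : step_group) : ~ conj_into (range step_mu) y ->
  centralizer_malnormal y /\ exists chi, centralizer_chart y chi.
Proof.
move=> Ey.
have [g [[x yx]|[]]] := hnn_hyperbolic_or_base step_sub1 step_subM
  step_subV step_phi_mem step_phiM step_phiK y.
  have [h [m Mm xm]] := step_absorbs x; case: Ey; exists (g * h).
  by apply/range_step_mu; exists m => //; rewrite conjgM yx xm.
by move=> y0 yy; apply: (@centralizer_conj _ _ g); exact: step_hyperbolic.
Qed.

Definition step_tower : tower_group := TowerGroup step_mu_inj step_enum_surj
  step_malnormal step_no2 step_centralizer.

End Step.

(** * Generation by the rationals and a free group *)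

Lemma is_subgroupP (U : groupType) (H : set U) :
  is_subgroup H <-> H 1 /\ forall x y, H x -> H y -> H (x / y).
Proof.
split=> -[H1 Hdiv]; split.
- by move: H1; rewrite inE.
- by move=> x y Hx Hy; have := Hdiv x y; rewrite !inE; apply.
- by rewrite inE.
- by move=> x y; rewrite !inE; exact: Hdiv.
Qed.

Section FreeSubgroup.
Variable T : tower_group.
Local Notation mu := (@tower_mu T).
Local Notation e := (@tower_enum T).
Local Notation sub := (@step_sub T).
Local Notation phi := (@step_phi T).
Local Notation base := (hnn_base sub phi).
Local Notation stable := (hnn_letter sub phi).
Local Notation S := (step_group T).
Local Notation nf := (@nf T sub phi).
Local Notation transv := (@transv T sub).

Let nfB := @nf_base _ _ phi (@step_sub1 T) (@step_subM T) (@step_subV T)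
  (@step_phi_mem T) (@step_phiM T) (@step_phiK T).
Let nfL := @nf_letter _ _ phi (@step_sub1 T) (@step_subM T) (@step_subV T)
  (@step_phi_mem T) (@step_phiM T) (@step_phiK T).
Let nf1 := nf1 (@step_sub1 T) (@step_subM T) (@step_subV T)
  (@step_phi_mem T) (@step_phiM T) (@step_phiK T).

Definition unit_shift : T := mu (1%R : rat).

Lemma unit_shift_neq1 : unit_shift <> 1.
Proof. by rewrite -(gmulf1 (s := mu)) => /tower_mu_inj. Qed.

(** Enumerates the elements other than 1, the value 1 being replaced by a nontrivial rational. *)
Definition nontrivial_enum j : T := if e j == 1 then unit_shift else e j.

Lemma nontrivial_enum_neq1 j : nontrivial_enum j <> 1.
Proof.
rewrite /nontrivial_enum; case: ifP => [_|/eqP //]; exact: unit_shift_neq1.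
Qed.

Lemma step_sub_odd n b u : odd n -> sub (n, b) u -> u = 1.
Proof.
move=> on; have act v : active_sub n v -> v = 1 by case=> // -[]; rewrite on.
case: b => [/act //|[v /act -> <-]]; exact: chart_mu1.
Qed.

Lemma transv_odd n b u : odd n -> transv (n, b) u = u.
Proof.
move=> on.
have /(step_sub_odd on)/mulg1_eq := transv_memV (@step_sub1 T) (@step_subV T) (n, b) u.
by rewrite invgK.
Qed.

(* The free generators: all stable letters of the extension, together with
   [g * t * q] for every [g <> 1] of the base, t a free stable letter of its own. *)
Definition free_letter_head (t : nat * bool) : T * letter :=
  let: (n, b) := t in
  if odd n then (if b then nontrivial_enum n./2 else unit_shift^-1, (n, b))
  else (1, (n./2, b)).

(** Read off from the inverse generator, so that inverting an image exchanges head and tail. For a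
    positive odd generator it is [unit_shift], for an even one it is 1. *)
Definition free_letter_tail (t : nat * bool) : T :=
  (free_letter_head (free_letter_inv t)).1^-1.

Definition free_letter_image (t : nat * bool) : S :=
  base (free_letter_head t).1 *
    (stable (free_letter_head t).2 * base (free_letter_tail t)).

Lemma free_letter_head_inv t :
  (free_letter_head (free_letter_inv t)).2 = letter_inv (free_letter_head t).2.
Proof. by case: t => n b; rewrite /free_letter_head /=; case: ifP. Qed.

Lemma free_letter_imageV t :
  free_letter_image (free_letter_inv t) = (free_letter_image t)^-1.
Proof.
rewrite /free_letter_image !invgM -mulgA -!gmulfV free_letter_head_inv hnn_letterV.
rewrite /free_letter_tail invgK; case: t => n b; rewrite /free_letter_inv /=.
by rewrite negbK.
Qed.

(** When an odd and an even generator use the same stable letter, the element between the two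
    letters is a single nontrivial head or tail, whereas that letter is odd and its associated
    subgroup trivial. So only inverse generators cancel. *)
Lemma free_letter_headP t s :
  (free_letter_head s).2 = letter_inv (free_letter_head t).2 ->
  transv (free_letter_head s).2 (free_letter_tail t * (free_letter_head s).1) = 1 ->
  s = free_letter_inv t.
Proof.
have eV : unit_shift^-1 <> 1 by move/eqP; rewrite invg_eq1 => /eqP/unit_shift_neq1.
have e1 := nontrivial_enum_neq1; have q1 := unit_shift_neq1.
have tr1 := transv_eq1 (@step_sub1 T) (@step_subV T).
case: t s => n b [m b']; rewrite /free_letter_tail /free_letter_head /=.
case: (boolP (odd n)) (boolP (odd m)) => on [] om //= [mn bb]; subst b'.
- rewrite mulg1 => /tr1; rewrite mn => /(step_sub_odd on) /eqP.
  by rewrite invg_eq1; case: (b) => /= /eqP => [/eV|/e1].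
- by rewrite invg1 mul1g => /tr1 /(step_sub_odd om); case: (b) => /= => [/eV|/e1].
- move=> _; congr (_, _); rewrite -[LHS]odd_double_half -[RHS]odd_double_half.
  by rewrite (negbTE on) (negbTE om) mn.
Qed.

Fixpoint reduced (w : seq (nat * bool)) : bool :=
  if w is t :: w' then (ohead w' != Some (free_letter_inv t)) && reduced w' else true.

Lemma reduced_exists (x : free_group nat) :
  exists2 w, reduced w & x = word_class _ _ w.
Proof.
elim/presented_ind: x => [|t x [w rw ->]]; first by exists [::].
case: (eqVneq (ohead w) (Some (free_letter_inv t))) => [|ht].
  case: w rw => // s w /= /andP[_ rw] [->]; exists w => //.
  by rewrite -word_class_cat; exact/word_classP/(word_cong_cancel _ _ [::]).
by exists (t :: w); [rewrite /= ht | rewrite -word_class_cat].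
Qed.

(** The first syllable survives in the image of a reduced word, which is therefore not 1; this is
    what makes the generators free. *)
Lemma starts_free_letter t w : reduced (t :: w) ->
  starts (free_letter_head t) (nf (word_eval free_letter_image (t :: w))).1.
Proof.
have trh s : transv (free_letter_head s).2 (free_letter_head s).1 =
    (free_letter_head s).1.
  case: s => n b; rewrite /free_letter_head.
  case: (boolP (odd n)) => on /=; first exact: transv_odd.
  exact: transv1 (@step_sub1 T) _.
have step (s : nat * bool) (x : S) :
    ~~ starts (1, letter_inv (free_letter_head s).2)
         (nf (base (free_letter_tail s) * x)).1 ->
    starts (free_letter_head s) (nf (free_letter_image s * x)).1.
  have -> : free_letter_image s * x = base (free_letter_head s).1 *
      (stable (free_letter_head s).2 * (base (free_letter_tail s) * x)).
    by rewrite /free_letter_image !mulgA.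
  move=> /negbTE ns; rewrite nfB nfL.
  by rewrite /letter_act ns /= mulg1 trh -surjective_pairing /starts /= eqxx.
elim: w t => [|s w IH] t rw; rewrite /word_eval big_cons -/(word_eval _ _); apply: step.
  by rewrite /word_eval big_nil nfB nf1.
have /andP[/= st rsw] : reduced (t :: s :: w) := rw.
have {IH} := IH s rsw; rewrite nfB.
case: (free_letter_head s) (@free_letter_headP t s) => r l /= H.
case: (nf _).1 => // -[r' l'] v; rewrite /starts /= => /eqP[-> ->].
by apply/eqP => -[e1 e2]; move/eqP: st; apply; congr Some; exact: H.
Qed.

Definition free_embedding : free_group nat -> S :=
  @presented_lift _ (@free_letter_inv nat) (fun _ _ => False) S free_letter_image.

Lemma free_embeddingM : {morph free_embedding : x y / x * y}.
Proof. by apply: presented_liftM => //; exact: free_letter_imageV. Qed.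

Lemma free_embedding1 : free_embedding 1 = 1.
Proof. by apply: (mulgI (free_embedding 1)); rewrite -free_embeddingM !mulg1. Qed.

HB.instance Definition _ := isUMagmaMorphism.Build (free_group nat) S free_embedding
  (conj free_embedding1 free_embeddingM).

Lemma free_embedding_word w :
  free_embedding (word_class _ _ w) = word_eval free_letter_image w.
Proof. by apply: presented_liftE => //; exact: free_letter_imageV. Qed.

Lemma free_embedding_inj : injective free_embedding.
Proof.
apply: gmulf_inj => x; have [[|t w] rw ->] := reduced_exists x; first by [].
move=> e; have := starts_free_letter rw.
have -> : word_eval free_letter_image (t :: w) = 1 by rewrite -free_embedding_word.
by rewrite nf1.
Qed.

Lemma free_embedding_gen n : free_embedding (free_gen n) = free_letter_image (n, true).
Proof. by rewrite free_embedding_word /word_eval big_cons big_nil mulg1. Qed.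

Lemma step_generated (H : set S) : is_subgroup H ->
  range (step_mu T) `<=` H -> range free_embedding `<=` H -> forall y, H y.
Proof.
move=> /is_subgroupP[H1 Hdiv] Hmu Hfree.
have HV x : H x -> H x^-1 by move=> Hx; rewrite -div1g; exact: Hdiv.
have HM x y : H x -> H y -> H (x * y).
  by move=> Hx Hy; rewrite -(invgK y); apply: Hdiv => //; exact: HV.
have Hl n : H (stable (n, true)).
  suff -> : stable (n, true) = free_embedding (free_gen n.*2).
    by apply: Hfree; exists (free_gen n.*2).
  rewrite free_embedding_gen /free_letter_image /free_letter_tail /free_letter_head /=.
  by rewrite odd_double doubleK invg1 hnn_base1 mul1g mulg1.
have Hq : H (base unit_shift) by apply: Hmu; exists (1%R : rat).
have Hb x : H (base x).
  have [->|/eqP x1] := eqVneq x 1; first by rewrite hnn_base1.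
  have [j ej] := tower_enum_surj x.
  have ej' : nontrivial_enum j = x by rewrite /nontrivial_enum ej; case: eqP.
  (* The generator of index 2j+1 is x t q; removing q, which is in M, and t, the generator of index
     2(2j+1), recovers x. *)
  suff -> : base x = free_embedding (free_gen j.*2.+1) *
      ((base unit_shift)^-1 * (stable (j.*2.+1, true))^-1).
    apply: (HM); first by apply: Hfree; exists (free_gen j.*2.+1).
    by apply: HM; apply: HV.
  rewrite free_embedding_gen /free_letter_image /free_letter_tail /free_letter_head /=.
  by rewrite odd_double /= uphalf_double ej' invgK -mulgA -invgM mulgV mulg1.
elim/hnn_ind => // [g x Hx|[n b] x Hx]; apply: HM => //; case: b => //.
by have := hnn_letterV sub phi (n, true) => ->; exact: HV.
Qed.

End FreeSubgroup.

(** * The rationals as bottom of the tower *)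

Section RatTower.

Let mu : UMagmaMorphism.type rat_group rat_group := idfun.

Let enum (n : nat) : rat_group := odflt (0%R : rat) (unpickle n).

Let mu_inj : injective mu. Proof. by []. Qed.

Let enum_surj (x : rat_group) : exists n, enum n = x.
Proof. by exists (pickle (x : rat)); rewrite /enum pickleK. Qed.

Let conj_range x : conj_into (range mu) x.
Proof. by exists 1; exists x => //; rewrite conjg1. Qed.

Let malnormal (a g : rat_group) :
  range mu a -> a <> 1 -> range mu (a ^ g) -> range mu g.
Proof. by move=> _ _ _; exists g. Qed.

Let no2 (g : rat_group) : g * g = 1 -> g = 1.
Proof.
move=> gg; have {}gg : ((g : rat) *+ 2 = 0)%R by [].
by apply/eqP; move/eqP: gg; rewrite Num.Theory.mulrn_eq0.
Qed.

Let centralizers (x : rat_group) : ~ conj_into (range mu) x ->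
  centralizer_malnormal x /\ exists chi, centralizer_chart x chi.
Proof. by move/(_ (conj_range x)). Qed.

Definition rat_tower : tower_group :=
  TowerGroup mu_inj enum_surj malnormal no2 centralizers.

(** M is the whole group, so nothing is exotic and every stable letter of the first step is free. *)
Lemma rat_tower_step_sub l (u : rat_tower) : step_sub l u -> u = 1.
Proof.
have act n v : active_sub n v -> v = 1 :> rat_tower.
  by case=> // -[_ [Ex _] _]; case: Ex; exact: conj_range.
case: l => n [/act //|[v /act -> <-]]; exact: chart_mu1.
Qed.

End RatTower.

(** * The first step is the free product of the rationals and F *)

Section FreeProductIso.
Local Notation S := (step_group rat_tower).
Local Notation FP := (free_product rat_group F_omega).
Local Notation base := (hnn_base (@step_sub rat_tower) (@step_phi rat_tower)).
Local Notation stable := (hnn_letter (@step_sub rat_tower) (@step_phi rat_tower)).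

Let letter_image (t : rat_tower + letter) : FP :=
  match t with
  | inl q => free_product_inl F_omega (q : rat_group)
  | inr (n, b) => free_product_inr rat_group
      (if b then free_gen n else (free_gen n)^-1)
  end.

Let inlV (q : rat_group) :
  free_product_inl F_omega q^-1 = (free_product_inl F_omega q)^-1.
Proof. exact: (word_class_inv _ _ (inl q)). Qed.

Let inrV (x : F_omega) :
  free_product_inr rat_group x^-1 = (free_product_inr rat_group x)^-1.
Proof. exact: (word_class_inv _ _ (inr x)). Qed.

Let letter_imageV t : letter_image (hnn_inv t) = (letter_image t)^-1.
Proof. by case: t => [q|[n []]] /=; rewrite ?inlV ?inrV ?invgK. Qed.

Let letter_image_rel r s : hnn_rel (@step_sub rat_tower) (@step_phi rat_tower) r s ->
  word_eval letter_image r = word_eval letter_image s.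
Proof.
case=> [a b|l a la]; rewrite /word_eval !big_cons big_nil !mulg1.
  by rewrite /= -free_product_inlM.
have -> : step_phi l a = 1 := rat_tower_step_sub (step_phi_mem la).
have -> : a = 1 := rat_tower_step_sub la.
have inl1 : free_product_inl F_omega (1 : rat_group) = 1.
  by apply: (mulgI (free_product_inl F_omega 1)); rewrite -free_product_inlM !mulg1.
by rewrite /= inl1 mul1g mulg1.
Qed.

Let back : S -> FP := presented_lift letter_image.

Let backM : {morph back : x y / x * y}.
Proof. exact: presented_liftM letter_imageV letter_image_rel. Qed.

Let back_letter t : back (word_class _ _ [:: t]) = letter_image t.
Proof.
rewrite /back (presented_liftE letter_imageV letter_image_rel).
by rewrite /word_eval big_cons big_nil mulg1.
Qed.

Let stableV t : stable (free_letter_inv t) = (stable t)^-1.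
Proof. exact: hnn_letterV. Qed.

Let free_part : F_omega -> S :=
  @presented_lift _ (@free_letter_inv nat) (fun _ _ => False) S stable.

Let free_partM : {morph free_part : x y / x * y}.
Proof. exact: presented_liftM. Qed.

Let free_part_letter t : free_part (word_class _ _ [:: t]) = stable t.
Proof. by rewrite /free_part presented_liftE // /word_eval big_cons big_nil mulg1. Qed.

Let factor (t : rat_group + F_omega) : S :=
  match t with inl q => base (q : rat_tower) | inr w => free_part w end.

Let factorV t : factor (free_product_inv t) = (factor t)^-1.
Proof.
case: t => [q|w] /=; first exact: gmulfV.
apply: (mulgI (free_part w)); rewrite mulgV -free_partM mulgV.
by apply: (mulgI (free_part 1)); rewrite -free_partM !mulg1.
Qed.

Let factor_rel r s : free_product_rel r s -> word_eval factor r = word_eval factor s.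
Proof.
case=> a b; rewrite /word_eval !big_cons big_nil !mulg1 /= ?free_partM //.
by rewrite -hnn_baseM.
Qed.

Let forth : FP -> S := presented_lift factor.

Let forthM : {morph forth : x y / x * y}.
Proof. exact: presented_liftM factorV factor_rel. Qed.

Let forth_letter t : forth (word_class _ _ [:: t]) = factor t.
Proof.
rewrite /forth (presented_liftE factorV factor_rel).
by rewrite /word_eval big_cons big_nil mulg1.
Qed.

Let forth1 : forth 1 = 1.
Proof. by apply: (mulgI (forth 1)); rewrite -forthM !mulg1. Qed.

Let back1 : back 1 = 1.
Proof. by apply: (mulgI (back 1)); rewrite -backM !mulg1. Qed.

HB.instance Definition _ := isUMagmaMorphism.Build FP S forth (conj forth1 forthM).

Let back_free_part w : back (free_part w) = free_product_inr rat_group w.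
Proof.
have inr1 : free_product_inr rat_group (1 : F_omega) = 1.
  by apply: (mulgI (free_product_inr rat_group 1)); rewrite -free_product_inrM !mulg1.
elim/presented_ind: w => [|t w IH].
  have -> : free_part 1 = 1.
    by apply: (mulgI (free_part 1)); rewrite -free_partM !mulg1.
  by rewrite back1 inr1.
rewrite free_partM backM IH free_part_letter back_letter free_product_inrM.
congr (_ * _); case: t => n [] //=; congr free_product_inr.
exact/esym/(word_class_inv _ _ (n, true)).
Qed.

Let forthK : cancel forth back.
Proof.
elim/presented_ind => [|t x IH]; first by rewrite forth1 back1.
rewrite forthM backM IH forth_letter; congr (_ * _).
by case: t => [q|w] /=; [rewrite back_letter | rewrite back_free_part].
Qed.

Let forth_surj y : range forth y.
Proof.
elim/hnn_ind: y => [|q x [z _ <-]|l x [z _ <-]]; first by exists 1; rewrite ?forth1.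
  exists (free_product_inl F_omega (q : rat_group) * z) => //.
  by rewrite forthM forth_letter.
exists (free_product_inr rat_group (word_class _ _ [:: l]) * z) => //.
by rewrite forthM forth_letter /= free_part_letter.
Qed.

Lemma step_rat_tower_iso :
  exists2 f : UMagmaMorphism.type FP S, injective f & forall y, range f y.
Proof. by exists forth; [exact: can_inj forthK | exact: forth_surj]. Qed.

End FreeProductIso.

(** * The union of the tower *)

Section ReducedProduct.
Local Open Scope quotient_scope.
Variable G : nat -> groupType.

(* The direct limit of a chain of groups lives in their product modulo eventual
   equality: an element of the k-th group becomes the sequence of its images from k on. *)
Definition sequences : Type := forall n, G n.
HB.instance Definition _ := gen_eqMixin sequences.
HB.instance Definition _ := gen_choiceMixin sequences.

Definition eventually_eq (f g : sequences) : Prop :=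
  exists N, forall n, (N <= n)%N -> f n = g n.

Definition eventually_eqb : rel sequences := fun f g => `[< eventually_eq f g >].

Lemma eventually_eqb_refl : reflexive eventually_eqb.
Proof. by move=> f; apply/asboolP; exists 0. Qed.

Lemma eventually_eqb_sym : symmetric eventually_eqb.
Proof.
by move=> f g; apply/idP/idP => /asboolP[N fg]; apply/asboolP; exists N => n /fg.
Qed.

Lemma eventually_eqb_trans : transitive eventually_eqb.
Proof.
move=> g f h /asboolP[N fg] /asboolP[K gh]; apply/asboolP; exists (maxn N K) => n.
by rewrite geq_max => /andP[/fg -> /gh].
Qed.

Canonical eventually_eqb_equiv := EquivRel eventually_eqb
  eventually_eqb_refl eventually_eqb_sym eventually_eqb_trans.

Definition reduced_product : Type := {eq_quot eventually_eqb}.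
HB.instance Definition _ := EqQuotient.on reduced_product.
HB.instance Definition _ := Choice.on reduced_product.

Definition seq_class (f : sequences) : reduced_product := \pi_reduced_product f.

Lemma seq_classP f g : seq_class f = seq_class g <-> eventually_eq f g.
Proof.
split; first by move=> /eqquotP /asboolP.
by move=> h; apply/eqquotP/asboolP.
Qed.

Lemma seq_class_repr x : seq_class (repr x) = x.
Proof. exact: reprK. Qed.

Lemma repr_seq_class f : eventually_eq (repr (seq_class f)) f.
Proof. by apply/seq_classP; rewrite seq_class_repr. Qed.

Definition reduced_one : reduced_product := seq_class (fun n => 1).
Definition reduced_mul (x y : reduced_product) : reduced_product :=
  seq_class (fun n => repr x n * repr y n).
Definition reduced_inv (x : reduced_product) : reduced_product :=
  seq_class (fun n => (repr x n)^-1).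

Lemma reduced_mulE f g :
  reduced_mul (seq_class f) (seq_class g) = seq_class (fun n => f n * g n).
Proof.
have [[N fN] [K gK]] := (repr_seq_class f, repr_seq_class g).
apply/seq_classP; exists (maxn N K) => n.
by rewrite geq_max => /andP[/fN -> /gK ->].
Qed.

Lemma reduced_invE f : reduced_inv (seq_class f) = seq_class (fun n => (f n)^-1).
Proof.
have [N fN] := repr_seq_class f.
by apply/seq_classP; exists N => n /fN ->.
Qed.

Lemma seq_class_ext f g : (forall n, f n = g n) -> seq_class f = seq_class g.
Proof. by move=> fg; apply/seq_classP; exists 0. Qed.

Lemma reduced_mulA : associative reduced_mul.
Proof.
move=> x y z; rewrite -(seq_class_repr x) -(seq_class_repr y) -(seq_class_repr z).
by rewrite !reduced_mulE; apply: seq_class_ext => n; rewrite mulgA.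
Qed.

Lemma reduced_mul1 : left_id reduced_one reduced_mul.
Proof.
move=> x; rewrite -(seq_class_repr x) reduced_mulE.
by apply: seq_class_ext => n; rewrite mul1g.
Qed.

Lemma reduced_mulr1 : right_id reduced_one reduced_mul.
Proof.
move=> x; rewrite -(seq_class_repr x) reduced_mulE.
by apply: seq_class_ext => n; rewrite mulg1.
Qed.

Lemma reduced_mulV : left_inverse reduced_one reduced_inv reduced_mul.
Proof.
move=> x; rewrite -(seq_class_repr x) reduced_invE reduced_mulE.
by apply: seq_class_ext => n; rewrite mulVg.
Qed.

Lemma reduced_mulrV : right_inverse reduced_one reduced_inv reduced_mul.
Proof.
move=> x; rewrite -(seq_class_repr x) reduced_invE reduced_mulE.
by apply: seq_class_ext => n; rewrite mulgV.
Qed.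

HB.instance Definition _ := isGroup.Build reduced_product
  reduced_mulA reduced_mul1 reduced_mulr1 reduced_mulV reduced_mulrV.

Lemma seq_classM f g :
  seq_class (fun n => f n * g n) = seq_class f * seq_class g.
Proof. by rewrite -reduced_mulE. Qed.

End ReducedProduct.

(** Induction on k shifts the family of groups, which avoids transport between types; the entries
    before k are filled with 1. *)
Lemma thread_exists (G : nat -> groupType) (iota : forall n, G n -> G n.+1) k
    (x : G k) :
  exists f : sequences G, f k = x /\ forall n, (k <= n)%N -> f n.+1 = iota n (f n).
Proof.
elim: k G iota x => [|k IH] G iota x.
  by exists (nat_rect (fun n => G n) x iota).
have [f [fk fS]] := IH (fun n => G n.+1) (fun n => iota n.+1) x.
by exists (fun n => if n is m.+1 then f m else 1); split=> // -[//|n] /fS.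
Qed.

Section DirectLimit.
Variables (G : nat -> groupType) (iota : forall n, UMagmaMorphism.type (G n) (G n.+1)).
Hypothesis iota_inj : forall n, injective (iota n).

Definition thread k (x : G k) : sequences G :=
  projT1 (cid (thread_exists (fun n => iota n) x)).

Lemma threadP k (x : G k) :
  thread x k = x /\ forall n, (k <= n)%N -> thread x n.+1 = iota n (thread x n).
Proof. exact: projT2 (cid (thread_exists (fun n => iota n) x)). Qed.

Definition to_limit k (x : G k) : reduced_product G := seq_class (thread x).

Lemma to_limitE k (x : G k) (f : sequences G) : f k = x ->
  (forall n, (k <= n)%N -> f n.+1 = iota n (f n)) -> to_limit x = seq_class f.
Proof.
move=> fk fS; have [xk xS] := threadP x; apply/seq_classP; exists k => n.
elim: n => [|n IH]; first by rewrite leqn0 => /eqP k0; subst k; rewrite xk fk.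
rewrite leq_eqVlt => /orP[/eqP kn|]; first by subst k; rewrite xk fk.
by rewrite ltnS => kn; rewrite xS // fS // IH.
Qed.

Lemma to_limit_next k (x : G k) : to_limit (iota k x) = to_limit x.
Proof.
have [xk xS] := threadP x; apply: to_limitE; first by rewrite xS // xk.
by move=> n /ltnW; exact: xS.
Qed.

Lemma to_limitM k : {morph @to_limit k : x y / x * y}.
Proof.
move=> x y; have [[xk xS] [yk yS]] := (threadP x, threadP y).
rewrite /to_limit -seq_classM; apply: to_limitE; first by rewrite xk yk.
by move=> n kn; rewrite xS // yS // gmulfM.
Qed.

Lemma to_limit1 k : @to_limit k 1 = 1.
Proof. by apply: (mulgI (to_limit (1 : G k))); rewrite -to_limitM !mulg1. Qed.

HB.instance Definition _ k := isUMagmaMorphism.Build (G k) (reduced_product G)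
  (@to_limit k) (conj (to_limit1 k) (@to_limitM k)).

Lemma to_limit_inj k : injective (@to_limit k).
Proof.
move=> x y /seq_classP[N xy]; have [[xk xS] [yk yS]] := (threadP x, threadP y).
have down d : thread x (k + d)%N = thread y (k + d)%N -> x = y.
  elim: d => [|d IH]; first by rewrite addn0 xk yk.
  by rewrite addnS xS ?yS ?leq_addr // => /iota_inj.
by apply: (down N); apply: xy; exact: leq_addl.
Qed.

Definition limit_level k : set (reduced_product G) := range (@to_limit k).

Lemma limit_level_next k : limit_level k `<=` limit_level k.+1.
Proof. by move=> _ [x _ <-]; exists (iota k x); rewrite ?to_limit_next. Qed.

Lemma limit_level_mono k l : (k <= l)%N -> limit_level k `<=` limit_level l.
Proof.
elim: l => [|l IH]; first by rewrite leqn0 => /eqP ->.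
rewrite leq_eqVlt => /orP[/eqP -> //|]; rewrite ltnS => /IH kl x /kl.
exact: limit_level_next.
Qed.

Lemma limit_level_subgroup k : is_subgroup (limit_level k).
Proof.
apply/is_subgroupP; split; first by exists 1; rewrite ?to_limit1.
by move=> _ _ [x _ <-] [y _ <-]; exists (x / y); rewrite ?gmulfF.
Qed.

End DirectLimit.

Lemma subgroup_iso_comp (H K U : groupType) (f : UMagmaMorphism.type H K)
    (j : UMagmaMorphism.type K U) :
  injective f -> injective j -> subgroup_iso (range (j \o f)) H.
Proof.
move=> f_inj j_inj; pose jf : UMagmaMorphism.type H U := j \o f.
by exists jf; split=> //; exact: inj_comp j_inj f_inj.
Qed.

(** * A criterion for CSA-groups by centralizers *)

Section CSACriterion.
Variable U : groupType.
Implicit Types (G A B : set U) (x y u v g : U).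

Lemma subgroup1 G : is_subgroup G -> G 1.
Proof. by case/is_subgroupP. Qed.

Lemma subgroupV G x : is_subgroup G -> G x -> G x^-1.
Proof. by case/is_subgroupP => G1 Gdiv Gx; rewrite -div1g; exact: Gdiv. Qed.

Lemma subgroupM G x y : is_subgroup G -> G x -> G y -> G (x * y).
Proof.
move=> sG Gx Gy; have [_ Gdiv] := (is_subgroupP G).1 sG.
by rewrite -(invgK y); apply: Gdiv => //; exact: subgroupV.
Qed.

Lemma subgroupJ G x y : is_subgroup G -> G x -> G y -> G (x ^ y).
Proof. by move=> sG Gx Gy; do ?[exact: subgroupV | apply: subgroupM]. Qed.

Definition malnormal_centralizers G : Prop := forall x, G x -> x <> 1 ->
  (forall u v, G u -> G v -> commute x u -> commute x v -> commute u v) /\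
  (forall u g, G u -> G g -> commute x u -> u <> 1 -> commute x (u ^ g) ->
     commute x g).

Lemma neq_singleton1 A : A 1 -> A <> [set 1] -> exists2 x, A x & x <> 1.
Proof.
move=> A1; apply: contra_notP => nA; rewrite eqEsubset; split=> [x Ax|x -> //].
by apply: contrapT => x1; apply: nA; exists x.
Qed.

Lemma centralizer_subgroup G x : is_subgroup G ->
  is_subgroup [set u | G u /\ commute x u].
Proof.
move=> /is_subgroupP[G1 Gdiv]; apply/is_subgroupP; split.
  by split=> //; exact: commute1.
move=> u v [Gu xu] [Gv xv]; split; first exact: Gdiv.
exact/commuteM/commuteV.
Qed.

(** A maximal abelian subgroup is the centralizer in G of any of its nontrivial elements, so
    malnormality passes to it. *)
Lemma csa_criterion G : is_subgroup G -> malnormal_centralizers G -> CSA_group G.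
Proof.
move=> sG mG; split=> // A [sA AG abA maxA] g Gg nAg.
have [A1 _] := (is_subgroupP A).1 sA.
have [] := neq_singleton1 _ nAg.
  by split=> //; exists 1 => //; rewrite conj1g.
move=> y [Abg [b Ab yb]] bg1; subst y.
have b1 : b <> 1 by move=> b1; apply: bg1; rewrite b1 conj1g.
have [cb mb] := mG b (AG b Ab) b1.
rewrite -(maxA [set u | G u /\ commute b u]).
- split=> //; apply: (mb b) => //; [exact: AG | exact: abA].
- exact: centralizer_subgroup.
- by move=> u [].
- by move=> u v [Gu bu] [Gv bv]; exact: cb.
- by move=> u Au; split; [exact: AG | exact: abA].
Qed.

End CSACriterion.

(** For x conjugate into M, malnormality of M conjugates the whole centralizer of x into M; the
    other elements are covered by the invariant. *)
Lemma tower_centralizers (T : tower_group) : malnormal_centralizers [set: T].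
Proof.
pose M := range (@tower_mu T).
move=> x _ x1; have [Ex|/contrapT[g Mxg]] := pselect (~ conj_into M x).
  split=> [u v _ _|u h _ _]; first exact: exotic_abelian.
  exact: exotic_malnormal.
have xg1 : x ^ g <> 1 by move/eqP; rewrite conjg_eq1 => /eqP.
have inM u : commute x u -> M (u ^ g).
  move=> xu; apply: (tower_malnormal Mxg xg1).
  by rewrite commute_conjg //; exact: commuteJ.
have commM u v : M (u ^ g) -> M (v ^ g) -> commute u v.
  move=> [a _ ag] [b _ bg]; rewrite -(conjgK g u) -(conjgK g v); apply: commuteJ.
  by rewrite -ag -bg; apply: gmulf_commute; exact: rat_group_mulC.
split=> [u v _ _ xu xv|u h _ _ xu u1 xuh]; first by apply: commM; exact: inM.
apply: commM => //; apply: (tower_malnormal (inM u xu)).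
  by move/eqP; rewrite conjg_eq1 => /eqP.
by rewrite -conjJg; exact: inM.
Qed.

(** * The chain, its union and the maximal abelian subgroups *)

Definition level (k : nat) : tower_group := iter k step_tower rat_tower.
Definition level_next k : UMagmaMorphism.type (level k) (level k.+1) :=
  hnn_base (@step_sub (level k)) (@step_phi (level k)).

Lemma level_next_inj k : injective (level_next k).
Proof.
by apply: hnn_base_inj; [exact: step_sub1 | exact: step_subM | exact: step_subV
  | exact: step_phi_mem | exact: step_phiM | exact: step_phiK].
Qed.

Local Notation embed k := (@to_limit level level_next k).
Local Notation stage k := (@limit_level level level_next k).

Lemma embed_inj k : injective (embed k).
Proof. exact: (to_limit_inj level_next_inj). Qed.

Lemma embed_commute k (x y : level k) : commute (embed k x) (embed k y) -> commute x y.
Proof. by rewrite /commute -!to_limitM => /embed_inj. Qed.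

Lemma embed_conjg k (x y : level k) : embed k (x ^ y) = embed k x ^ embed k y.
Proof. exact: gmulfJ. Qed.

Lemma embed_neq1 k (x : level k) : embed k x <> 1 -> x <> 1.
Proof. by move=> x1 e; apply: x1; rewrite e to_limit1. Qed.

Lemma stage_centralizers k : malnormal_centralizers (stage k).
Proof.
move=> _ [x _ <-] /embed_neq1 x1; have [cx mx] := tower_centralizers I x1.
split=> [_ _ [u _ <-] [v _ <-]|_ _ [u _ <-] [g _ <-]].
  move=> /embed_commute xu /embed_commute xv.
  by rewrite /commute -!to_limitM (cx u v).
move=> /embed_commute xu /embed_neq1 u1; rewrite -embed_conjg => /embed_commute xug.
by rewrite /commute -!to_limitM (mx u g).
Qed.

Definition rational_stage : set (reduced_product level) := range (embed 0).

Lemma embed_mu k (a : rat_group) : embed k (@tower_mu (level k) a) = embed 0 a.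
Proof.
elim: k => [//|k IH].
by rewrite -IH -(to_limit_next level_next (@tower_mu (level k) a)).
Qed.

Lemma rational_stageP k (x : level k) :
  rational_stage (embed k x) <-> range (@tower_mu (level k)) x.
Proof.
split=> [[a _]|[a _ <-]]; last by exists a; rewrite ?embed_mu.
by rewrite -(embed_mu k) => /embed_inj <-; exists a.
Qed.

Lemma rational_stage_malnormal k a g : rational_stage a -> a <> 1 -> stage k g ->
  rational_stage (a ^ g) -> rational_stage g.
Proof.
move=> [b _ <-] + [h _ <-]; rewrite -(embed_mu k) => /embed_neq1 b1.
rewrite -embed_conjg => /rational_stageP bh; apply/rational_stageP.
by apply: tower_malnormal bh => //; exists b.
Qed.

Lemma stage_absorbed k x : stage k x ->
  exists2 g, stage k.+1 g & rational_stage (x ^ g).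
Proof.
move=> [y _ <-]; have [z [m Mm yz]] := step_absorbs y.
exists (embed k.+1 z); first by exists z.
rewrite -(to_limit_next level_next y) -embed_conjg; apply/rational_stageP.
by apply/range_step_mu; exists m.
Qed.

Definition union_stage : set (reduced_product level) :=
  \bigcup_(k in [set k | (1 <= k)%N]) stage k.

Lemma stage_sub_union k : stage k `<=` union_stage.
Proof.
(* The union starts at index 1, so going up one stage also covers k = 0, the rationals. *)
by move=> x kx; exists k.+1 => //; exact: (limit_level_next (k := k)).
Qed.

Lemma union_stage3 x y z : union_stage x -> union_stage y -> union_stage z ->
  exists k, [/\ stage k x, stage k y & stage k z].
Proof.
move=> [i _ ix] [j _ jy] [k _ kz]; exists (maxn i (maxn j k)).
by split; [move: x ix | move: y jy | move: z kz]; apply: limit_level_mono; lia.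
Qed.

Lemma union_stage_subgroup : is_subgroup union_stage.
Proof.
apply/is_subgroupP; split.
  by apply: (stage_sub_union (k := 0)); exists 1; rewrite ?to_limit1.
move=> x y Ux Uy; have [k [kx ky _]] := union_stage3 Ux Uy Uy.
apply: (stage_sub_union (k := k)).
by have [_ +] := (is_subgroupP _).1 (limit_level_subgroup level_next k); apply.
Qed.

(** The condition involves three elements at a time, and these lie in a common stage. *)
Lemma union_stage_centralizers : malnormal_centralizers union_stage.
Proof.
move=> x Ux x1; split=> u v Uu Uv; have [k [kx ku kv]] := union_stage3 Ux Uu Uv;
  have [cx mx] := stage_centralizers kx x1; [exact: cx | exact: mx].
Qed.

Lemma rational_stage_sub : rational_stage `<=` union_stage.
Proof. by move=> _ [a _ <-]; apply: (stage_sub_union (k := 0)); exists a. Qed.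

Lemma rational_stage_subgroup : is_subgroup rational_stage.
Proof. exact: limit_level_subgroup. Qed.

Lemma rational_stage_abelian : is_abelian rational_stage.
Proof.
move=> _ _ [a _ <-] [b _ <-].
by apply: gmulf_commute; exact: rat_group_mulC.
Qed.

Lemma rational_stage_nontrivial : exists2 a, rational_stage a & a <> 1.
Proof.
exists (embed 0 ((1%R : rat) : rat_group)); first by eexists.
by rewrite -(to_limit1 level_next 0) => /embed_inj.
Qed.

(** A nontrivial a in A has a conjugate a^g in the rationals. Everything in A commutes with a, so
    malnormality of the rationals in each stage puts A^g inside them, and maximality gives
    equality. *)
Lemma union_max_abelian A : max_abelian_subgroup union_stage A ->
  exists2 g, union_stage g & A = conj_set rational_stage g.
Proof.
move=> [sA AU abA maxA]; have sU := union_stage_subgroup.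
have sR := rational_stage_subgroup.
have [An1|nA1] := pselect (A = [set 1]).
  have [a Ra a1] := rational_stage_nontrivial.
  have RA : rational_stage = A.
    apply: maxA => //; first exact: rational_stage_sub.
      exact: rational_stage_abelian.
    by rewrite An1 => _ ->; exact: subgroup1.
  by case: a1; move: Ra; rewrite RA An1.
have [a Aa a1] := neq_singleton1 (subgroup1 sA) nA1.
have [k _ ka] := AU a Aa; have [g kg Rag] := stage_absorbed ka.
have Ug : union_stage g by exact: stage_sub_union kg.
exists g^-1; first exact: subgroupV.
apply/esym/maxA.
- apply/is_subgroupP; have [R1 Rdiv] := (is_subgroupP _).1 sR.
  split; first by exists 1 => //; rewrite conj1g.
  move=> _ _ [x Rx <-] [y Ry <-]; exists (x / y); first exact: Rdiv.
  by rewrite conjMg conjVg.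
- move=> _ [x Rx <-]; apply: subgroupJ => //; last exact: subgroupV.
  exact: rational_stage_sub.
- by move=> _ _ [x Rx <-] [y Ry <-]; apply/commuteJ/rational_stage_abelian.
move=> b Ab; exists (b ^ g); last exact: conjgK.
have [l [_ lg lb]] := union_stage3 Ug Ug (AU b Ab).
apply: (rational_stage_malnormal (k := l) Rag).
- by move/eqP; rewrite conjg_eq1 => /eqP.
- by apply: subgroupJ => //; exact: limit_level_subgroup.
- by rewrite -conjJg (commute_conjg (abA a b Aa Ab)).
Qed.

Lemma rational_stage_divisible : divisible rational_stage.
Proof.
move=> n n0 _ [a _ <-].
exists (embed 0 (((a : rat) / n%:R)%R : rat_group)); first by eexists.
rewrite -gmulfXn; congr (embed 0 _).
suff -> : ((((a : rat) / n%:R)%R : rat_group) ^+ n) =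
    (((a : rat) / n%:R) *+ n)%R :> rat.
  by rewrite -GRing.mulr_natr GRing.divfK // Num.Theory.pnatr_eq0 -lt0n.
by elim: (n) => // m IH; rewrite expgS GRing.mulrS IH.
Qed.

(** A nontrivial rational q and a free letter t do not commute: the normal form of q t starts with q
    and that of t q with 1. *)
Lemma union_not_abelian : ~ is_abelian union_stage.
Proof.
pose q : rat_tower := unit_shift rat_tower.
pose b := hnn_base (@step_sub rat_tower) (@step_phi rat_tower) q.
pose t := hnn_letter (@step_sub rat_tower) (@step_phi rat_tower) (1%N, true).
move=> abU; have : commute (embed 1 b) (embed 1 t).
  by apply: abU; apply: (stage_sub_union (k := 1)); eexists.
move=> /embed_commute; rewrite /commute -[X in X = _]mulg1 -mulgA => bt.
have C1 := @step_sub1 rat_tower; have CM := @step_subM rat_tower.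
have CV := @step_subV rat_tower; have Pm := @step_phi_mem rat_tower.
have PM := @step_phiM rat_tower; have PK := @step_phiK rat_tower.
have := congr1 (fun x => (nf x).1) bt.
rewrite (nf_base C1 CM CV Pm PM PK) !(nf_letter C1 CM CV Pm PM PK).
rewrite (nf1 C1 CM CV Pm PM PK) (nf_of_base C1 CM CV Pm PM PK) /letter_act /= => -[].
rewrite (@transv_odd rat_tower 1 true) // mulg1; exact: (@unit_shift_neq1 rat_tower).
Qed.

Theorem mainTheorem2 :
  exists (U : groupType) (G : nat -> set U),
    [/\ forall k, (1 <= k)%N -> CSA_group (G k),
        forall k, (1 <= k)%N -> G k `<=` G k.+1,
        subgroup_iso (G 1%N) (free_product rat_group F_omega),
        forall k, (1 <= k)%N ->
          exists A B : set U,
            [/\ subgroup_iso A rat_group, subgroup_iso B F_omega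
              & G k = subgroup_generated (A `|` B)]
      & let Gunion := \bigcup_(k in [set k | (1 <= k)%N]) G k in
        [/\ CSA_group Gunion,
            ~ is_abelian Gunion,
            forall A B, max_abelian_subgroup Gunion A ->
              max_abelian_subgroup Gunion B -> conjugate_in Gunion A B
          & forall A, max_abelian_subgroup Gunion A -> divisible A]].
Proof.
exists (reduced_product level), (fun k => stage k); split.
- move=> k _; apply: csa_criterion; first exact: limit_level_subgroup.
  exact: stage_centralizers.
- by move=> k _; exact: limit_level_next.
- have [f f_inj f_surj] := step_rat_tower_iso.
  have -> : stage 1 = range (embed 1 \o f).
    rewrite eqEsubset; split=> [_ [y _ <-]|_ [x _ <-]]; last by exists (f x).
    by have [x _ <-] := f_surj y; exists x.
  exact: (subgroup_iso_comp (j := embed 1) f_inj (@embed_inj 1)).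
(* A stage of positive index is a step over the previous level, so both embeddings are available. *)
- case=> // k _.
  pose fe : UMagmaMorphism.type F_omega (level k.+1) := @free_embedding (level k).
  exists (range (embed k.+1 \o step_mu (level k))),
    (range (embed k.+1 \o fe)); split.
  + exact: (subgroup_iso_comp (j := embed k.+1) (@step_mu_inj (level k))
      (@embed_inj k.+1)).
  + have fe_inj : injective fe := @free_embedding_inj (level k).
    exact: (subgroup_iso_comp (j := embed k.+1) fe_inj (@embed_inj k.+1)).
  rewrite eqEsubset; split; last first.
    apply: smallest_sub; first exact: limit_level_subgroup.
    by move=> _ [] [x _ <-]; eexists.
  move=> _ [y _ <-] H [sH SH].
  apply: (@step_generated (level k) [set y | H (embed k.+1 y)]).
  + have [H1 Hdiv] := (is_subgroupP H).1 sH; apply/is_subgroupP; split.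
      by rewrite /= to_limit1.
    by move=> x z Hx Hz; rewrite /= gmulfF; exact: Hdiv.
  + by move=> _ [a _ <-]; apply: SH; left; exists a.
  + by move=> _ [a _ <-]; apply: SH; right; exists a.
rewrite /= -/union_stage; split.
- exact: csa_criterion union_stage_subgroup union_stage_centralizers.
- exact: union_not_abelian.
- move=> A B /union_max_abelian[g Ug ->] /union_max_abelian[h Uh ->].
  exists (g^-1 * h).
    have sU := union_stage_subgroup.
    by apply: subgroupM => //; exact: subgroupV.
  rewrite eqEsubset; split=> [_ [x Rx <-]|_ [_ [x Rx <-] <-]].
    by exists (x ^ g); [exists x | rewrite conjgM conjgK].
  by exists x; rewrite // conjgM conjgK.
move=> A /union_max_abelian[g Ug ->] n n0 _ [a Ra <-].
have [b Rb <-] := rational_stage_divisible n0 Ra.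
by exists (b ^ g); [exists b | rewrite conjXg].
Qed.
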